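(* Let $M\ge 2$ be an integer, $N=3M-2$, $M_1=(N-4)/3$, $M_2=(N+2)/3$. For $0\le n\le m\le M_1$ define $$\Psi_{mn}[z_1,\dots,z_{M_1};w_1,\dots,w_{M_2}]=\frac1{N^2}\sum_{\gamma,\delta=1}^N(\bar\eta_\gamma)^m(\bar\eta_\delta)^n\prod_{i=1}^{M_1}(\eta_\gamma-z_i)(\eta_\delta-z_i)\;\Psi_0[z_i;w_k],$$ let $|\Psi_{mn}\rangle$ be the corresponding state, and put $\ell_{\mathrm m}=\min(M_1-m,n)$. Then for all $0\le n\le m\le M_1$: (i) $$\begin{aligned}H_{\mathrm{SU(3)}}|\Psi_{mn}\rangle=&-\frac{\pi^2}{18}\left(N-\frac{17}{N}+\frac{52}{N^2}\right)|\Psi_{mn}\rangle+\frac{3\pi^2}{N^2}\left[(M_1-m)m+(M_1-n)n-\frac23(m-n)\right]|\Psi_{mn}\rangle\\&-\frac{4\pi^2}{N^2}\sum_{\ell=1}^{\ell_{\mathrm m}}(m-n+2\ell)\,|\Psi_{m+\ell,n-\ell}\rangle.\end{aligned}$$ (ii) The state $$|\Phi_{mn}\rangle=\sum_{\ell=0}^{\ell_{\mathrm m}}a_\ell^{mn}|\Psi_{m+\ell,n-\ell}\rangle,$$ with $a_0^{mn}=1$ and $$a_\ell^{mn}=\frac{(\ell-\frac53)(m-n+\ell-1)(m-n+2\ell)}{\ell\,(m-n+\ell+\frac23)(m-n+2\ell-2)}\,a_{\ell-1}^{mn}\qquad(\ell\ge1)$$ (where for $m=n$ and $\ell=1$ the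 recursion is to be read as $a_1^{mm}=-\frac45$), is an exact energy eigenstate, $H_{\mathrm{SU(3)}}|\Phi_{mn}\rangle=E_{mn}|\Phi_{mn}\rangle$, with $$E_{mn}=-\frac{\pi^2}{18}\left(N-\frac{17}{N}+\frac{52}{N^2}\right)+\frac{3\pi^2}{N^2}\left[(M_1-m)m+(M_1-n)n-\frac23(m-n)\right].$$ (iii) With the single-coloron momenta $$p_m=\frac{4\pi}3-\frac{2\pi}N(m+1),\qquad p_n=\frac{4\pi}3-\frac{2\pi}N\left(n+\frac13\right),$$ one has $$E_{mn}=E_0+\frac49\frac{\pi^2}{N^2}+\epsilon(p_m)+\epsilon(p_n),$$ where $E_0=-\frac{\pi^2}{18}\left(N+\frac7N\right)$ and $\epsilon(p)=\frac34\left(\frac{\pi^2}9-(p-\pi)^2\right)$; in particular $p_n-p_m=\frac{2\pi}N\left(\frac23+\text{integer}\right)$.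
   Context: The Hilbert space is $(\mathbb C^3)^{\otimes N}$, each site $\alpha=1,\dots,N$ having orthonormal basis b (blue), r (red), g (green). The sites are identified with the $N$-th roots of unity $\eta_\alpha=\exp(2\pi i\alpha/N)$. The colorflip operator $e_\alpha^{\sigma\tau}$ is the matrix unit $|\sigma\rangle\langle\tau|$ acting on site $\alpha$. The SU(3) Haldane--Shastry Hamiltonian is $$H_{\mathrm{SU(3)}}=\frac{2\pi^2}{N^2}\sum_{1\le\alpha<\beta\le N}\ \sum_{\sigma,\tau\in\{\mathrm b,\mathrm r,\mathrm g\}}\frac{e_\alpha^{\sigma\tau}e_\beta^{\tau\sigma}-\frac1{27}}{|\eta_\alpha-\eta_\beta|^2}.$$ A wave function $\Psi[z_1,\dots,z_{M_1};w_1,\dots,w_{M_2}]$, symmetric in the $z_i$ and symmetric in the $w_k$, represents the state $$|\Psi\rangle=\sum_{\{z_i,w_k\}}\Psi[z_i;w_k]\;e_{z_1}^{\mathrm{bg}}\cdots e_{z_{M_1}}^{\mathrm{bg}}e_{w_1}^{\mathrm{rg}}\cdots e_{w_{M_2}}^{\mathrm{rg}}|0_{\mathrm g}\rangle,$$ where $|0_{\mathrm g}\rangle$ is the state with every site green, and the sum is over all ways of placing the blue particles $\{z_i\}$ and red particles $\{w_k\}$ on pairwise distinct sites of the lattice $\{\eta_1,\dots,\eta_N\}$. Further, $$\Psi_0[z_i;w_k]=\prod_{i<j}^{M_1}(z_i-z_j)^2\prod_{k<l}^{M_2}(w_k-w_l)^2\prod_{i=1}^{M_1}\prod_{k=1}^{M_2}(z_i-w_k)\prod_{i=1}^{M_1}z_i\prod_{k=1}^{M_2}w_k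 .$$ *)

(* Defs.v *)
From HB Require Import structures.
From mathcomp Require Import all_boot all_order all_algebra.
From mathcomp Require Import reals trigo.
From mathcomp Require Import complex.

Set Implicit Arguments.
Unset Strict Implicit.
Unset Printing Implicit Defensive.

Import Order.TTheory GRing.Theory Num.Theory.

Local Open Scope ring_scope.
Local Open Scope complex_scope.

Definition color := 'I_3.
Definition blue : color := @Ordinal 3 0 isT.
Definition red : color := @Ordinal 3 1 isT.
Definition green : color := @Ordinal 3 2 isT.

Section States.
Variables (R : realType) (N : nat).

(* (C^3)^{(x) N} is represented by the coordinates of its vectors in the
   product basis |c>, where c ranges over the colorings of the N sites. *)
Definition config := {ffun 'I_N -> color}.
Definition state := {ffun config -> R[i]^o}.

Definition ket (c : config) : state := [ffun c' => (c' == c)%:R].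

Definition recolor (c : config) (a : 'I_N) (s : color) : config :=
  [ffun b => if b == a then s else c b].

(* The matrix unit |s><t| acting on site a: it sends |c> to |recolor c a s>
   if c a = t, and to 0 otherwise. *)
Definition colorflip (a : 'I_N) (s t : color) (psi : state) : state :=
  \sum_(c : config | c a == t) psi c *: ket (recolor c a s).

(* a : 'I_N stands for the site alpha = a + 1 of {1, ..., N}, and
   eta a = exp (2 pi i alpha / N). *)
Definition eta (a : 'I_N) : R[i] :=
  let theta : R := 2 * pi * a.+1%:R / N%:R in cos theta +i* sin theta.

Definition hamiltonian (psi : state) : state :=
  (2 * pi ^+ 2 / N%:R ^+ 2 : R)%:C *:
  \sum_(a < N) \sum_(b < N | (a < b)%N)
    (`|eta a - eta b| ^+ 2)^-1 *:
    \sum_(s : color) \sum_(t : color)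
      (colorflip a s t (colorflip b t s psi) - (27%:R)^-1 *: psi).

Definition is_eigenstate (E : R) (psi : state) : Prop :=
  psi != 0 /\ hamiltonian psi = E%:C *: psi.

Section WaveFunctions.
Variables (M1 M2 : nat).

Definition wavefun := ('I_M1 -> R[i]) -> ('I_M2 -> R[i]) -> R[i].

(* Each way of placing M1 blue and M2 red particles on pairwise distinct
   sites is counted once, by listing the particles of either color in
   increasing order of their sites. *)
Definition is_placement (z : {ffun 'I_M1 -> 'I_N}) (w : {ffun 'I_M2 -> 'I_N})
    : bool :=
  [&& [forall i : 'I_M1, forall j : 'I_M1, (i < j)%N ==> (z i < z j)%N],
      [forall k : 'I_M2, forall l : 'I_M2, (k < l)%N ==> (w k < w l)%N]
    & [forall i : 'I_M1, forall k : 'I_M2, z i != w k]].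

Definition all_green : state := ket [ffun=> green].

(* e_{z_1}^{bg} ... e_{z_M1}^{bg} e_{w_1}^{rg} ... e_{w_M2}^{rg} |0_g> *)
Definition placed (z : {ffun 'I_M1 -> 'I_N}) (w : {ffun 'I_M2 -> 'I_N})
    : state :=
  foldr (fun i => colorflip (z i) blue green)
    (foldr (fun k => colorflip (w k) red green) all_green (enum 'I_M2))
    (enum 'I_M1).

Definition state_of (Psi : wavefun) : state :=
  \sum_(z : {ffun 'I_M1 -> 'I_N})
    \sum_(w : {ffun 'I_M2 -> 'I_N} | is_placement z w)
      Psi (fun i => eta (z i)) (fun k => eta (w k)) *: placed z w.

Definition Psi0 : wavefun := fun z w =>
  (\prod_(i < M1) \prod_(j < M1 | (i < j)%N) (z i - z j) ^+ 2) *
  (\prod_(k < M2) \prod_(l < M2 | (k < l)%N) (w k - w l) ^+ 2) *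
  (\prod_(i < M1) \prod_(k < M2) (z i - w k)) *
  (\prod_(i < M1) z i) * (\prod_(k < M2) w k).

Definition Psi_wf (m n : nat) : wavefun := fun z w =>
  (N%:R ^+ 2)^-1 *
  \sum_(g < N) \sum_(d < N)
    ((eta g)^*)%R ^+ m * ((eta d)^*)%R ^+ n *
    (\prod_(i < M1) ((eta g - z i) * (eta d - z i))) * Psi0 z w.

Definition Psi_st (m n : nat) : state := state_of (Psi_wf m n).

End WaveFunctions.
End States.

Definition ell_max (M1 m n : nat) : nat := minn (M1 - m) n.

Section Coefficients.
Variable R : realType.

(* For m = n, l = 1 the recursion formula is 0 / 0; its prescribed value
   there is -4/5. *)
Fixpoint coef_a (m n l : nat) : R :=
  match l with
  | 0 => 1
  | l'.+1 =>
      if (m == n) && (l == 1)%N then - (4%:R / 5%:R)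
      else
        let d : R := m%:R - n%:R in
        let x : R := l%:R in
        ((x - 5%:R / 3%:R) * (d + x - 1) * (d + 2 * x)) /
        (x * (d + x + 2 / 3%:R) * (d + 2 * x - 2)) * coef_a m n l'
  end.

Definition Phi_st (N M1 M2 m n : nat) : state R N :=
  \sum_(0 <= l < (ell_max M1 m n).+1)
    (coef_a m n l)%:C *: Psi_st R N M1 M2 (m + l) (n - l).

Definition energy (N M1 m n : nat) : R :=
  - (pi ^+ 2 / 18%:R) * (N%:R - 17%:R / N%:R + 52%:R / N%:R ^+ 2) +
  3%:R * pi ^+ 2 / N%:R ^+ 2 *
    ((M1%:R - m%:R) * m%:R + (M1%:R - n%:R) * n%:R
     - 2 / 3%:R * (m%:R - n%:R)).

Definition E0 (N : nat) : R := - (pi ^+ 2 / 18%:R) * (N%:R + 7%:R / N%:R).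

Definition dispersion (p : R) : R :=
  3%:R / 4%:R * (pi ^+ 2 / 9%:R - (p - pi) ^+ 2).

Definition momentum_m (N m : nat) : R :=
  4%:R * pi / 3%:R - 2 * pi / N%:R * (m%:R + 1).

Definition momentum_n (N n : nat) : R :=
  4%:R * pi / 3%:R - 2 * pi / N%:R * (n%:R + 3%:R^-1).

End Coefficients.

(* Main.v *)
From HB Require Import structures.
From mathcomp Require Import all_boot all_order all_algebra all_fingroup.
From mathcomp Require Import reals trigo.
From mathcomp Require Import complex.
From mathcomp Require Import ring lra zify.
Require Import Defs.

(** Write c_k for the coefficients of Z(x) = prod_i (x - z_i).  Orthogonality of
    the characters of Z/N gives Psi_mn = c_m c_n Psi_0.

    For a polynomial f of degree at most N, the sum of f(eta_b) / |eta_a - eta_b|^2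
    over b <> a is a second-order differential operator applied to f at eta_a.
    Since Psi_0 is a product of linear factors, blue-green and red-green exchanges
    are given by this operator; so are blue-red exchanges, once the wave function
    is rewritten in terms of the blue and green coordinates.  The three-body
    identity x_ab x_ac + x_ba x_bc + x_ca x_cb = 1, with x_ab = eta_a / (eta_a - eta_b),
    turns the zeroth-order terms into a constant.  On a symmetric function of the
    z_i what remains is the operator
      sum_i z_i^2 d_i^2 + (2 - (N - 1) / 2) sum_i z_i d_i
        + 3 sum_(i <> j) z_i^2 / (z_i - z_j) d_i,
    whose action on c_m c_n is triangular.  The eigenvector then follows from the
    partial sums of its coefficients.  It is nonzero because a form of degree at
    most 2 in each z_i that vanishes at all tuples of distinct N-th roots of unity
    vanishes identically. *)

Set Implicit Arguments.
Unset Strict Implicit.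
Unset Printing Implicit Defensive.

Import Order.TTheory GRing.Theory Num.Theory.

Local Open Scope ring_scope.

(** * Sums over the roots of unity *)

(** Taken alone, neither exchange that moves a blue particle acts through the blue coordinates only:
    the logarithmic derivative of the amplitude brings in the red sites ([XS R a]) for blue-green
    and the green sites ([XS U a]) for blue-red. Their sum does, because X_B + X_R + X_U is the
    constant c = (N - 1) / 2 at every site: the total first-order coefficient 2 + 4 X_B + X_R + X_U
    - 2 c becomes 2 - c + 3 X_B. This is the origin of the coupling 3 and of the constant 2 - (N -
    1) / 2. The filling matters through degrees. There are M_1 + 2 red and M_1 + 2 green sites, and
    N = 3 M_1 + 4, so the amplitude as a function of one moving coordinate has degree at most N - 1
    for each of the three exchanges, within the range where a lattice sum is a differential
    operator. Partial sums of the coefficients appear because the weight with which H sends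
    Psi_(m+l,n-l) to Psi_(m+j,n-j) is proportional to m - n + 2 j: it depends on the target and not
    on l. *)

Section LogDerivative.
Variable F : fieldType.
Implicit Types (p r : {poly F}) (t c l q : F).

(** Here [l] stands for t p'(t) / p(t), the sum of t / (t - u) over the roots u of [p], and [q] for
    the sum of the squares of the same terms. In this form both data are additive under products and
    nothing is divided by p(t). *)
Definition log_derivs p t l q : Prop :=
  t * p^`().[t] = p.[t] * l /\ t ^+ 2 * p^`()^`().[t] = p.[t] * (l ^+ 2 - q).

Lemma log_derivs1 t : log_derivs 1 t 0 0.
Proof.
by rewrite /log_derivs -(polyC1 F) derivC deriv0 !hornerC; split; ring.
Qed.

Lemma log_derivsM p r t l1 q1 l2 q2 :
  log_derivs p t l1 q1 -> log_derivs r t l2 q2 ->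
  log_derivs (p * r) t (l1 + l2) (q1 + q2).
Proof.
move=> [p1 p2] [r1 r2]; rewrite /log_derivs !(derivM, derivD) !(hornerM, hornerD).
split.
  transitivity ((t * p^`().[t]) * r.[t] + p.[t] * (t * r^`().[t])); first by ring.
  by rewrite p1 r1; ring.
transitivity ((t ^+ 2 * p^`()^`().[t]) * r.[t]
  + 2 * (t * p^`().[t]) * (t * r^`().[t]) + p.[t] * (t ^+ 2 * r^`()^`().[t])).
  by ring.
by rewrite p2 r2 p1 r1; ring.
Qed.

Lemma log_derivsX t : log_derivs 'X t 1 1.
Proof.
by rewrite /log_derivs derivX -(polyC1 F) derivC !(hornerM, hornerD, hornerN, hornerX,
  hornerC); split; ring.
Qed.

Lemma log_derivs_XsubC t c :
  t != c -> log_derivs ('X - c%:P) t (t / (t - c)) ((t / (t - c)) ^+ 2).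
Proof.
rewrite -subr_eq0 => tc; rewrite /log_derivs derivXsubC -(polyC1 F) derivC !(hornerM,
  hornerD, hornerN, hornerX, hornerC).
by split; [field|ring].
Qed.

Lemma log_derivs_prod (I : Type) (s : seq I) (P : pred I) (u : I -> F) t :
  (forall i, P i -> t != u i) ->
  log_derivs (\prod_(i <- s | P i) ('X - (u i)%:P)) t
    (\sum_(i <- s | P i) t / (t - u i)) (\sum_(i <- s | P i) (t / (t - u i)) ^+ 2).
Proof.
move=> tu; elim: s => [|i s IH].
  by rewrite !big_nil; apply: log_derivs1.
rewrite !big_cons; case: ifP => // Pi.
by apply: log_derivsM => //; apply: log_derivs_XsubC; apply: tu.
Qed.

End LogDerivative.

(** * Lattice sums as differential operators *)

Section Lattice.
Variables (F : numFieldType) (N : nat) (e : 'I_N -> F).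
Hypothesis e_inj : injective e.
Hypothesis e_prod : \prod_(a < N) ('X - (e a)%:P) = 'X^N - 1.
Hypothesis e_pow : forall k : nat, (0 < k < N)%N -> \sum_(b < N) e b ^+ k = 0.

Definition xx (a b : 'I_N) : F := e a / (e a - e b).
(* For roots of unity this is 1 / |e a - e b|^2. *)
Definition dinv (a b : 'I_N) : F := xx a b * xx b a.

Lemma eB_neq0 a b : a != b -> e a - e b != 0.
Proof. by move=> ab; rewrite subr_eq0 (inj_eq e_inj). Qed.

Lemma eN a : e a ^+ N = 1.
Proof.
have : ('X^N - 1 : {poly F}).[e a] = 0.
  rewrite -e_prod horner_prod (bigD1 a) //= !(hornerM, hornerD, hornerN, hornerX,
    hornerC).
  by rewrite subrr mul0r.
by rewrite !(hornerD, hornerN, hornerXn, hornerC) => /eqP; rewrite subr_eq0 => /eqP.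
Qed.

Lemma e_neq0 a : e a != 0.
Proof.
apply/eqP => e0; have := eN a; have N0 : (0 < N)%N by case: (a) => i; case: N.
by rewrite e0 expr0n eqn0Ngt N0 => /eqP; rewrite eq_sym oner_eq0.
Qed.

Lemma xxC a b : a != b -> xx a b + xx b a = 1.
Proof.
move=> ab; rewrite /xx; have := eB_neq0 ab; have := eB_neq0 (a := b) (b := a).
rewrite eq_sym => /(_ ab) h1 h2; field.
by rewrite h1 h2.
Qed.

Lemma dinvC a b : dinv a b = dinv b a.
Proof. by rewrite /dinv mulrC. Qed.

Lemma dinvE a b : a != b -> dinv a b = xx a b - xx a b ^+ 2.
Proof. by move=> ab; rewrite /dinv -[xx b a](addKr (xx a b)) xxC //; ring. Qed.

Lemma dinv_sq a b : a != b -> dinv a b = - (e a * e b) / (e a - e b) ^+ 2.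
Proof.
move=> ab; rewrite /dinv /xx; have h := eB_neq0 ab.
have h' : e b - e a != 0 by rewrite eB_neq0 // eq_sym.
by field; rewrite h h'.
Qed.

Lemma xx_triple a b c : a != b -> b != c -> a != c ->
  xx a b * xx a c + xx b a * xx b c + xx c a * xx c b = 1.
Proof.
move=> ab bc ac; rewrite /xx.
have := (eB_neq0 ab, eB_neq0 bc, eB_neq0 ac).
have ba : b != a by rewrite eq_sym.
have cb : c != b by rewrite eq_sym.
have ca : c != a by rewrite eq_sym.
have := (eB_neq0 ba, eB_neq0 cb, eB_neq0 ca) => -[[h1 h2] h3] [[h4 h5] h6].
by field; rewrite h1 h2 h3 h4 h5 h6.
Qed.

(** The values, the same at every site a, of the sums of [xx a b] and of [dinv a b] over all b other
    than a. *)
Definition lattice_xx : F := (N%:R - 1) / 2.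
Definition lattice_dinv : F := (N%:R ^+ 2 - 1) / 12.

Let Q a : {poly F} := \prod_(b < N | b != a) ('X - (e b)%:P).

Lemma QP a : ('X - (e a)%:P) * Q a = 'X^N - 1.
Proof. by rewrite -e_prod (bigD1 a). Qed.

(* Both sums are read off the first three derivatives of
   'X^N - 1 = ('X - e a) * Q a at e a. *)
Lemma xx_sums a : \sum_(b < N | b != a) xx a b = lattice_xx /\
  \sum_(b < N | b != a) xx a b ^+ 2 = lattice_xx - lattice_dinv.
Proof.
have hneq b : b != a -> e a != e b by move=> ba; rewrite (inj_eq e_inj) eq_sym.
have [] := @log_derivs_prod F _ (index_enum 'I_N) (fun b => b != a) e (e a) hneq.
rewrite -/(Q a) -/(xx _ _).
set l := \sum_(i <- _ | _) _; set q := \sum_(i <- _ | _) _ => H1 H2.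
have D1 : (('X - (e a)%:P) * Q a)^`().[e a] = (Q a).[e a].
  by rewrite derivM derivXsubC mul1r !(hornerM, hornerD, hornerN, hornerX, hornerC) subrr
    mul0r addr0.
have D2 : (('X - (e a)%:P) * Q a)^`()^`().[e a] = 2 * (Q a)^`().[e a].
  by rewrite derivM derivXsubC mul1r derivD derivM derivXsubC mul1r !(hornerM, hornerD,
    hornerN, hornerX, hornerC) subrr mul0r; ring.
have D3 : (('X - (e a)%:P) * Q a)^`()^`()^`().[e a] = 3 * (Q a)^`()^`().[e a].
  by rewrite derivM derivXsubC mul1r derivD derivM derivXsubC mul1r !derivD derivM
    derivXsubC mul1r !(hornerM, hornerD, hornerN, hornerX, hornerC) subrr mul0r; ring.
have hq : (Q a).[e a] != 0.
  rewrite horner_prod; apply/prodf_neq0 => b ba; rewrite !(hornerM, hornerD, hornerN,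
    hornerX, hornerC).
  by rewrite subr_eq0 hneq.
have N0 : (0 < N)%N by case: (a) => i; case: N.
have ea0 := e_neq0 a.
have h1 : (Q a).[e a] * e a = N%:R.
  rewrite -D1 QP derivB derivXn (derivC 1) subr0 hornerMn hornerXn mulrnAl.
  by rewrite -exprSr prednK // eN.
have h2 : 2 * ((Q a)^`().[e a] * e a ^+2) = N%:R * (N%:R - 1).
  rewrite mulrA -D2 QP derivB derivXn (derivC 1) subr0 derivMn derivXn !hornerMn hornerXn
    !mulrnAl.
  case: (N) N0 (eN a) => // [] [|k] _ //=; first by rewrite mulr0n mul0rn subrr mulr0.
  rewrite -exprD addn2 => ->; rewrite -mulrnA.
  have -> : (k.+2%:R - 1 : F) = k.+1%:R by rewrite -[k.+2%:R]natr1 addrK.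
  by rewrite mul1r -mulrnA.
have h3 : 3 * ((Q a)^`()^`().[e a] * e a ^+3) = N%:R * (N%:R - 1) * (N%:R - 2).
  rewrite mulrA -D3 QP !(derivB, derivMn, derivXn, derivC) subr0 !hornerMn hornerXn
    !mulrnAl.
  case: (N) N0 (eN a) => // [] [|[|k]] _ //=; first by move=> _; ring.
    by move=> _; ring.
  rewrite -exprD addn3 => ->; rewrite -!mulrnA.
  have -> : (k.+3%:R - 1 : F) = k.+2%:R by rewrite -[k.+3%:R]natr1 addrK.
  have -> : (k.+3%:R - 2 : F) = k.+1%:R.
    by rewrite -[k.+3]addn2 natrD; ring.
  by rewrite mul1r -[LHS]/(1 *+ _) mulrnA mulrnA mulr_natl -[in RHS]mulr_natl mulr_natl
    -!mulrnA; congr (_ *+ _); lia.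
have Nr : N%:R != 0 :> F by rewrite pnatr_eq0 -lt0n.
have hl : l = lattice_xx.
  apply: (mulfI hq); rewrite -H1 /lattice_xx; apply: (mulfI ea0).
  have -> : e a * (e a * (Q a)^`().[e a]) = (2 * ((Q a)^`().[e a] * e a ^+ 2)) / 2.
    by field.
  by rewrite h2 -h1; field.
split => //; have : (Q a).[e a] * (l ^+ 2 - q) = (Q a).[e a] * ((N%:R - 1) * (N%:R - 2) /
  3).
  apply: (mulfI ea0); rewrite -H2.
  have -> : e a * (e a ^+ 2 * (Q a)^`()^`().[e a]) = (3 * ((Q a)^`()^`().[e a] * e a ^+
    3)) / 3.
    by field.
  by rewrite h3 -h1; field.
move/(mulfI hq) => h4.
rewrite -[LHS]/q.
have -> : q = l ^+ 2 - (N%:R - 1) * (N%:R - 2) / 3 by rewrite -h4; ring.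
by rewrite hl /lattice_xx /lattice_dinv; field.
Qed.

Lemma xx_sum a : \sum_(b < N | b != a) xx a b = lattice_xx.
Proof. by have [] := xx_sums a. Qed.

Lemma xx_sq_sum a : \sum_(b < N | b != a) xx a b ^+ 2 = lattice_xx - lattice_dinv.
Proof. by have [] := xx_sums a. Qed.

Lemma dinv_sum a : \sum_(b < N | b != a) dinv a b = lattice_dinv.
Proof.
transitivity (\sum_(b < N | b != a) (xx a b - xx a b ^+ 2)).
  by apply: eq_bigr => b ba; rewrite dinvE // eq_sym.
by rewrite sumrB xx_sum xx_sq_sum; ring.
Qed.

Let S a k : F := \sum_(b < N | b != a) dinv a b * e b ^+ k.

(* Taking second differences in the exponent cancels the double pole of
   dinv a b at e b = e a. *)
Lemma hop_step a k : (0 < k < N)%N ->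
  S a k.+1 - 2 * e a * S a k + e a ^+ 2 * S a k.-1 = e a ^+ k.+1.
Proof.
(* The power sum over all sites vanishes, so omitting b = a leaves [- e a ^+ k]; the factor [- e a]
   is what [dinv a b * (e b - e a) ^+ 2] contributes besides [e b]. *)
move=> hk; have : - e a * \sum_(b < N | b != a) e b ^+ k = e a ^+ k.+1.
  have := e_pow hk; rewrite (bigD1 a) //= => /eqP; rewrite addr_eq0 => /eqP h.
  by rewrite exprS h; ring.
move=> <-; rewrite /S !mulr_sumr -sumrB -big_split /=.
apply: eq_bigr => b ba; have hb : e a - e b != 0 by rewrite eB_neq0 // eq_sym.
rewrite dinv_sq 1?eq_sym //; case: k hk => // k _ /=.
by rewrite !exprS; field.
Qed.

(** The recurrence of [hop_step] has the double characteristic root [e a], so with its forcing term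
    the solution is [e a ^+ k] times a quadratic polynomial in k, fixed by the cases 0 and 1. The
    exponent N is still reached, since the last step uses the power sum of exponent N - 1. *)
Lemma hop_monomial a k : (k <= N)%N ->
  S a k = e a ^+ k * (lattice_dinv - lattice_xx * k%:R + k%:R * (k%:R - 1) / 2).
Proof.
have S0 : S a 0 = lattice_dinv.
  by rewrite /S -(dinv_sum a); apply: eq_bigr => b _; rewrite expr0 mulr1.
have S1 : S a 1 = e a * (lattice_dinv - lattice_xx).
  have : S a 1 - e a * S a 0 = - e a * lattice_xx.
    transitivity (\sum_(b < N | b != a) (e a * xx a b - e a)).
      rewrite /S !mulr_sumr -sumrB; apply: eq_bigr => b ba.
      have hb : e a - e b != 0 by rewrite eB_neq0 // eq_sym.
      by rewrite dinv_sq 1?eq_sym // /xx; field.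
    rewrite sumrB -mulr_sumr xx_sum sumr_const (cardC1 a) card_ord -mulr_natr.
    have hN : N%:R = N.-1%:R + 1 :> F.
      by rewrite natr1 prednK //; case: (a) => i; case: N.
    by rewrite /lattice_xx hN; field.
  by rewrite S0 => /eqP; rewrite subr_eq => /eqP ->; ring.
elim: k {-2}k (leqnn k) => [|n IH] [|[|k]] //.
- by move=> _ _; rewrite S0; ring.
- by move=> _ _; rewrite S0; ring.
- by move=> _ _; rewrite S1; ring.
move=> kn kN; have := @hop_step a k.+1 kN.
rewrite (IH k.+1 kn (ltnW kN)) (IH k (ltnW kn) (ltnW (ltnW kN))).
move/eqP; rewrite /= addrAC subr_eq => /eqP h.
have -> : S a k.+2 = (S a k.+2 + e a ^+ 2 * (e a ^+ k * (lattice_dinv - lattice_xx * k%:R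
  + k%:R * (k%:R - 1) / 2)))
   - e a ^+ 2 * (e a ^+ k * (lattice_dinv - lattice_xx * k%:R + k%:R * (k%:R - 1) / 2))
     by ring.
by rewrite h -[k.+2]addn2 -[k.+1]addn1 !natrD !exprD; field.
Qed.

Lemma hop_sum a (f : {poly F}) : (size f <= N.+1)%N ->
  \sum_(b < N | b != a) dinv a b * f.[e b] =
  lattice_dinv * f.[e a] - lattice_xx * (e a * f^`().[e a]) + e a ^+ 2 * f^`()^`().[e a]
    / 2.
Proof.
move=> sf.
pose L (g : {poly F}) := \sum_(b < N | b != a) dinv a b * g.[e b] -
  (lattice_dinv * g.[e a] - lattice_xx * (e a * g^`().[e a]) + e a ^+ 2 * g^`()^`().[e a]
    / 2).
suff: L f = 0 by move/eqP; rewrite subr_eq0 => /eqP.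
have LD g h : L (g + h) = L g + L h.
  rewrite /L !derivD !hornerD.
  under eq_bigr do rewrite hornerD mulrDr.
  by rewrite big_split /=; field.
have LZ c g : L (c *: g) = c * L g.
  rewrite /L !derivZ !hornerZ.
  under eq_bigr do rewrite hornerZ mulrCA.
  by rewrite -mulr_sumr; field.
have L0 : L 0 = 0 by rewrite -[X in L X](scale0r 0) LZ mul0r.
rewrite -[f]coefK poly_def (big_morph L LD L0).
apply: big1 => i _; rewrite LZ; apply/eqP; rewrite mulf_eq0; apply/orP; right.
rewrite /L subr_eq0; apply/eqP.
under eq_bigr do rewrite hornerXn.
have iN : (i <= N)%N by have := ltn_ord i; lia.
have := hop_monomial a iN; rewrite /S => ->.
rewrite derivXn derivMn derivXn !hornerMn !hornerXn.
case: (nat_of_ord i) => [|[|k]] /=; [by rewrite ?mulr0n ?mul0rn; ring | by rewrite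
  ?mulr0n ?mul0rn; field|].
have hk : e a ^+ k *+ k.+1 *+ k.+2 = e a ^+ k * (k%:R + 1) * (k%:R + 2).
  by rewrite -(mulr_natr (e a ^+ k)) -mulr_natr -[k.+2]addn2 -[k.+1]addn1 !natrD.
have hk1 : e a ^+ k.+1 *+ k.+2 = e a ^+ k * e a * (k%:R + 2).
  by rewrite -mulr_natr -[k.+2]addn2 natrD exprSr.
by rewrite hk hk1 -[k.+2]addn2 natrD exprD; field.
Qed.

End Lattice.

(** * Two- and three-body sums *)

Section DoubleSums.
Variables (V : pzSemiRingType) (I : finType).
Implicit Types (S T : {set I}) (f : I -> I -> V).

Lemma sum_neq_swap S f :
  \sum_(a in S) \sum_(b in S | b != a) f a b =
  \sum_(a in S) \sum_(b in S | b != a) f b a.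
Proof.
rewrite (exchange_big_dep (mem S)) => [|a b _ /andP[]] //=.
by apply: eq_bigr => b bS; apply: eq_bigl => a; rewrite bS /= eq_sym.
Qed.

Lemma sum_neq_card S :
  \sum_(a in S) \sum_(b in S | b != a) (1 : V) = (#|S| * #|S|.-1)%:R.
Proof.
transitivity (\sum_(a in S) (#|S|.-1)%:R : V); last first.
  by rewrite sumr_const mulnC mulrnA.
apply: eq_bigr => a aS.
rewrite sumr_const; congr (_ *+ _).
rewrite [in RHS](cardsD1 a S) aS /=; apply: eq_card => b.
by rewrite !inE andbC.
Qed.

End DoubleSums.

Section Sums.
Variables (F : numFieldType) (N : nat) (e : 'I_N -> F).
Hypothesis e_inj : injective e.
Implicit Types (S T B R U : {set 'I_N}) (a b x : 'I_N).

Local Notation xx := (xx e).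
Local Notation dinv := (dinv e).

Definition XS S a : F := \sum_(b in S | b != a) xx a b.
Definition QS S a : F := \sum_(b in S | b != a) xx a b ^+ 2.
Definition DS S a : F := \sum_(b in S | b != a) dinv a b.

Lemma DSE S a : DS S a = XS S a - QS S a.
Proof.
rewrite /DS /XS /QS -sumrB; apply: eq_bigr => b /andP[_ ba] /=.
by rewrite dinvE // eq_sym.
Qed.

Lemma card_predr S : (#|S| * #|S|.-1)%:R = #|S|%:R * (#|S|%:R - 1) :> F.
Proof.
case: #|S| => [|k]; first by rewrite mul0n mul0r.
by rewrite /= natrM -[k.+1%:R]natr1 addrK.
Qed.

Lemma XS_self S : \sum_(a in S) XS S a = #|S|%:R * (#|S|%:R - 1) / 2.
Proof.
have h : \sum_(a in S) XS S a + \sum_(a in S) XS S a = #|S|%:R * (#|S|%:R - 1).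
  rewrite [X in _ + X]sum_neq_swap -big_split -card_predr -sum_neq_card /=.
  apply: eq_bigr => a aS; rewrite -big_split; apply: eq_bigr => b /andP[_ ba] /=.
  by rewrite xxC // eq_sym.
by rewrite -h; field.
Qed.

Lemma disjoint_neq S T a b : [disjoint S & T] -> a \in S -> b \in T -> b != a.
Proof.
move=> dST aS bT; apply: contraTneq aS => <-.
by rewrite (disjointFl dST bT).
Qed.

Lemma sum_disjoint S T (f : 'I_N -> F) a : [disjoint S & T] -> a \in S ->
  \sum_(b in T | b != a) f b = \sum_(b in T) f b.
Proof.
move=> dST aS; apply: eq_bigl => b; case bT: (b \in T) => //=.
by rewrite (disjoint_neq dST aS bT).
Qed.

Lemma XS_cross S T : [disjoint S & T] ->
  \sum_(a in S) XS T a + \sum_(b in T) XS S b = #|S|%:R * #|T|%:R.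
Proof.
move=> dST; have dTS : [disjoint T & S] by rewrite disjoint_sym.
under eq_bigr => a aS do rewrite /XS (sum_disjoint _ dST aS).
under [X in _ + X]eq_bigr => a aS do rewrite /XS (sum_disjoint _ dTS aS).
rewrite [X in _ + X]exchange_big -big_split /=.
transitivity (\sum_(a in S) (#|T|%:R : F)); last first.
  by rewrite sumr_const mulr_natl.
apply: eq_bigr => a aS; rewrite -big_split /= -[RHS]mulr1 mulr_natl -sumr_const.
by apply: eq_bigr => b bT; rewrite xxC // eq_sym (disjoint_neq dST aS bT).
Qed.

Lemma DS_cross S T : [disjoint S & T] ->
  \sum_(a in S) DS T a = \sum_(b in T) DS S b.
Proof.
move=> dST; have dTS : [disjoint T & S] by rewrite disjoint_sym.
under eq_bigr => a aS do rewrite /DS (sum_disjoint _ dST aS).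
under [RHS]eq_bigr => a aS do rewrite /DS (sum_disjoint _ dTS aS).
by rewrite exchange_big; do 2![apply: eq_bigr => ? _]; rewrite dinvC.
Qed.

(** The three-body identity for a, b, x, summed over ordered pairs of distinct a, b in [S]. The
    terms centred at a and at b have equal sums, whence the factor 2; those centred at x form the
    square of [XS S x] without its diagonal [QS S x]. *)
Lemma triple_single S x : x \notin S ->
  2 * (\sum_(a in S) XS S a * xx a x) + XS S x ^+ 2 = QS S x + #|S|%:R * (#|S|%:R - 1).
Proof.
move=> xS.
have xneq a : a \in S -> a != x by move=> aS; apply: contraNneq xS => <-.
have h1 : XS S x ^+ 2 = QS S x + \sum_(a in S) \sum_(b in S | b != a) xx x a * xx x b.
  have -> : XS S x = \sum_(a in S) xx x a.
    by apply: eq_bigl => a; case aS: (a \in S); rewrite //= xneq.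
  have -> : QS S x = \sum_(a in S) xx x a ^+ 2.
    by apply: eq_bigl => a; case aS: (a \in S); rewrite //= xneq.
  rewrite expr2 mulr_suml -big_split; apply: eq_bigr => a aS /=.
  by rewrite mulr_sumr (bigD1 a) //= expr2.
have h2 : \sum_(a in S) XS S a * xx a x = \sum_(a in S) \sum_(b in S | b != a) xx a b *
  xx a x.
  by apply: eq_bigr => a aS; rewrite mulr_suml.
have h3 := sum_neq_swap S (fun a b => xx a b * xx a x).
rewrite mulr_natl mulr2n {1}h2 h2 [in X in _ + X + _]h3 h1 addrCA.
congr (_ + _); rewrite -!big_split -card_predr -sum_neq_card.
apply: eq_bigr => a aS; rewrite -!big_split; apply: eq_bigr => b /andP[bS ba] /=.
rewrite -(@xx_triple _ _ _ e_inj a b x) ?xneq //; last by rewrite eq_sym.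
Qed.

Lemma triple_cross S T : [disjoint S & T] ->
  2 * (\sum_(a in S) XS S a * XS T a) + \sum_(x in T) XS S x ^+ 2 =
  \sum_(x in T) QS S x + #|S|%:R * (#|S|%:R - 1) * #|T|%:R.
Proof.
move=> dST.
have -> : \sum_(a in S) XS S a * XS T a = \sum_(x in T) \sum_(a in S) XS S a * xx a x.
  rewrite exchange_big; apply: eq_bigr => a aS.
  by rewrite {2}/XS (sum_disjoint _ dST aS) mulr_sumr.
rewrite mulr_sumr -big_split mulr_natr -sumr_const -big_split /=.
apply: eq_bigr => x xT; apply: triple_single.
by rewrite (disjointFl dST xT).
Qed.

Lemma XS_setU1 S x a : x \notin S -> a \in S -> XS (x |: S) a = XS S a + xx a x.
Proof.
move=> xS aS; rewrite /XS big_mkcondr big_setU1 //= -big_mkcondr /= addrC.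
by rewrite ifT //; apply: contraNneq xS => ->.
Qed.

Lemma QS_setU1 S x a : x \notin S -> a \in S -> QS (x |: S) a = QS S a + xx a x ^+ 2.
Proof.
move=> xS aS; rewrite /QS big_mkcondr big_setU1 //= -big_mkcondr /= addrC.
by rewrite ifT //; apply: contraNneq xS => ->.
Qed.

Lemma XS_setU1_self S x : x \notin S -> XS (x |: S) x = XS S x.
Proof.
by move=> xS; rewrite /XS big_mkcondr big_setU1 //= -big_mkcondr /= eqxx add0r.
Qed.

Lemma QS_setU1_self S x : x \notin S -> QS (x |: S) x = QS S x.
Proof.
by move=> xS; rewrite /QS big_mkcondr big_setU1 //= -big_mkcondr /= eqxx add0r.
Qed.

(** Off the diagonal, the squares collect twice the three-body identity for each unordered triple,
    which gives n (n - 1) (n - 2) / 3. The proof adds one site at a time through [triple_single]. *)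
Lemma triple_self S :
  \sum_(a in S) XS S a ^+ 2 =
  \sum_(a in S) QS S a + #|S|%:R * (#|S|%:R - 1) * (#|S|%:R - 2) / 3.
Proof.
elim: {S}#|S| {-2}S (erefl #|S|) => [S /cards0_eq ->|n IHn S' S'n].
  by rewrite !big_set0 cards0; ring.
have /card_gt0P [x xS'] : (0 < #|S'|)%N by rewrite S'n.
have xS : x \notin S' :\ x by rewrite !inE eqxx.
have IH : #|S' :\ x| = n by move: (cardsD1 x S'); rewrite xS' S'n => -[].
rewrite -(setD1K xS'); move: (S' :\ x) xS IH => S xS /IHn IH {S' xS' S'n IHn}.
rewrite !big_setU1 //= XS_setU1_self // QS_setU1_self // cardsU1 xS /= natrD.
rewrite (eq_bigr (fun a => XS S a ^+ 2 + 2 * (XS S a * xx a x) + xx a x ^+ 2)) => [|a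
  aS]; last first.
  by rewrite XS_setU1 //; ring.
rewrite [in RHS](eq_bigr (fun a => QS S a + xx a x ^+ 2)) => [|a aS]; last first.
  by rewrite QS_setU1.
rewrite !big_split /= IH -mulr_sumr.
have -> : 2 * (\sum_(a in S) XS S a * xx a x) = QS S x + #|S|%:R * (#|S|%:R - 1) - XS S x
  ^+ 2.
  by rewrite -(triple_single xS); ring.
by field.
Qed.


Lemma sum_const S (k : F) : \sum_(a in S) k = #|S|%:R * k.
Proof. by rewrite sumr_const mulr_natl. Qed.

(** * Zeroth-order terms for a lattice split into three colors *)

Section Partition.
Hypothesis e_prod : \prod_(a < N) ('X - (e a)%:P) = 'X^N - 1.
Variables B R U : {set 'I_N}.
Hypothesis dBR : [disjoint B & R].
Hypothesis dBU : [disjoint B & U].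
Hypothesis dRU : [disjoint R & U].
Hypothesis cBRU : B :|: R :|: U = setT.

Local Notation c := (lattice_xx F N).
Local Notation A := (lattice_dinv F N).
Local Notation X := XS.
Local Notation Q := QS.
Local Notation D := DS.

Lemma partition_sum (P : pred 'I_N) (f : 'I_N -> F) :
  \sum_(b in B | P b) f b + \sum_(b in R | P b) f b
    + \sum_(b in U | P b) f b = \sum_(b < N | P b) f b.
Proof.
rewrite !big_mkcondl /= -!big_split /=; apply: eq_bigr => b _.
have : b \in B :|: R :|: U by rewrite cBRU inE.
rewrite !inE; case bB: (b \in B) => /=.
  by rewrite (disjointFr dBR bB) (disjointFr dBU bB) !addr0.
case bR: (b \in R) => /=; last by move=> bU; rewrite bU !add0r.
move=> _.
by rewrite (disjointFr dRU bR) add0r addr0.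
Qed.

Lemma XS_partition a : X B a + X R a + X U a = c.
Proof. by rewrite partition_sum xx_sum. Qed.

Lemma QS_partition a : Q B a + Q R a + Q U a = c - A.
Proof. by rewrite partition_sum xx_sq_sum. Qed.

Lemma DS_partition a : D B a + D R a + D U a = A.
Proof. by rewrite partition_sum dinv_sum. Qed.

Lemma card_partition : #|B|%:R + #|R|%:R + #|U|%:R = N%:R :> F.
Proof.
transitivity (\sum_(b < N | true) (1 : F)); last by rewrite sumr_const card_ord.
rewrite -(partition_sum (fun=> true)) -!sumr_const.
by congr (_ + _ + _); apply: eq_bigl => b; rewrite andbT.
Qed.

(* The zeroth-order term of hop_sum divided by f.[e a], for f with
   log_derivs f (e a) l q. *)
Definition hop_const (l q : F) : F := A - c * l + (l ^+ 2 - q) / 2.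

(** The left side gathers every zeroth-order contribution: blue-green and blue-red hops, red-green
    hops, and pairs of equal color, which are counted twice and hence halved. Once the green sums
    are eliminated, the two- and three-body sums cancel all dependence on positions. The right side
    contains cardinalities only, so it is a scalar. *)
Lemma constant_sum :
  let n : F := #|B|%:R in let r : F := #|R|%:R in
  \sum_(a in B) (hop_const (1 + 2 * X B a + X R a) (1 + 2 * Q B a + Q R a)
     + hop_const (1 + 2 * X B a + X U a) (1 + 2 * Q B a + Q U a))
  + \sum_(a in R) hop_const (1 + 2 * X R a + X B a) (1 + 2 * Q R a + Q B a)
  + (\sum_(a in B) D B a + \sum_(a in R) D R a + \sum_(a in U) D U a) / 2
  = n * (2 * A - c * (2 + c) + ((1 + c) ^+ 2 - 1 - c + A) / 2) + r * (A - c)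
    + (3 - 2 * c) * (n * (n - 1) / 2) + (1 - c) * (r * (r - 1)) - c * n * r
    + n * (n - 1) * r / 2 + r * (r - 1) * n + 5 / 6 * (n * (n - 1) * (n - 2))
    + 2 / 3 * (r * (r - 1) * (r - 2)) + n * (n - 1) / 2 + r * (r - 1) / 2
    + n * r + N%:R * A / 2 - n * A - r * A.
Proof.
move=> n r.
have dRB : [disjoint R & B] by rewrite disjoint_sym.
rewrite (eq_bigr (fun a => (2 * A - c * (2 + c) + ((1 + c) ^+ 2 - 1 - c + A) / 2)
  + (3 - 2 * c) * X B a - c * X R a + (5 / 2) * X B a ^+ 2 + X R a ^+ 2
  + X B a * X R a - (3 / 2) * Q B a)); last first.
  move=> a _; rewrite /hop_const.
  have -> : X U a = c - X B a - X R a by rewrite -(XS_partition a); ring.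
  have -> : Q U a = c - A - Q B a - Q R a by rewrite -(QS_partition a); ring.
  by field.
rewrite [X in _ + X + _](eq_bigr (fun a => (A - c) + (2 - 2 * c) * X R a
  + (1 - c) * X B a + 2 * X R a ^+ 2 + X B a ^+ 2 / 2 + 2 * (X R a * X B a)
  - Q R a - Q B a / 2)); last first.
  by move=> a _; rewrite /hop_const; field.
rewrite !(big_split, sumrB) /= !sum_const -!mulr_sumr -!mulr_suml.
rewrite !sumrN -!mulr_sumr -!mulr_suml -/n -/r.
have e1 := XS_self B; have e2 := XS_self R.
have e3 := triple_self B; have e4 := triple_self R.
have e5 : \sum_(a in B) X B a * X R a =
    (\sum_(x in R) Q B x + n * (n - 1) * r - \sum_(x in R) X B x ^+ 2) / 2.
  by rewrite -(triple_cross dBR); field.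
have e6 : \sum_(a in R) X R a * X B a =
    (\sum_(x in B) Q R x + r * (r - 1) * n - \sum_(x in B) X R x ^+ 2) / 2.
  by rewrite -(triple_cross dRB); field.
have e7 : \sum_(a in R) X B a = n * r - \sum_(a in B) X R a.
  by rewrite -(XS_cross dBR); ring.
have dB : \sum_(a in B) D B a = \sum_(a in B) X B a - \sum_(a in B) Q B a.
  by rewrite -sumrB; apply: eq_bigr => a _; rewrite DSE.
have dR : \sum_(a in R) D R a = \sum_(a in R) X R a - \sum_(a in R) Q R a.
  by rewrite -sumrB; apply: eq_bigr => a _; rewrite DSE.
have dX : \sum_(a in B) D R a = \sum_(a in B) X R a - \sum_(a in B) Q R a.
  by rewrite -sumrB; apply: eq_bigr => a _; rewrite DSE.
have tot S : \sum_(a in S) D B a + \sum_(a in S) D R a + \sum_(a in S) D U a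
    = #|S|%:R * A.
  by rewrite -!big_split -sum_const; apply: eq_bigr => a _; exact: DS_partition.
(* Each site has total weight A, and cross sums between two colors are symmetric, so the green-green
   sum is determined by the blue and red ones. *)
have dU : \sum_(a in U) D U a = (N%:R - 2 * n - 2 * r) * A + \sum_(a in B) D B a
    + \sum_(a in R) D R a + 2 * \sum_(a in B) D R a.
  have tB := tot B; have tR := tot R; have := tot U.
  rewrite -(DS_cross dBU) -(DS_cross dRU).
  rewrite -(DS_cross dBR) in tR.
  have -> : \sum_(a in B) D U a = n * A - \sum_(a in B) D B a - \sum_(a in B) D R a.
    by rewrite /n -tB; ring.
  have -> : \sum_(a in R) D U a = r * A - \sum_(a in B) D R a - \sum_(a in R) D R a.
    by rewrite /r -tR; ring.
  have -> : #|U|%:R = N%:R - n - r :> F by rewrite -card_partition /n /r; ring.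
  move=> h; rewrite -[LHS](addKr ((n * A - \sum_(a in B) D B a - \sum_(a in B) D R a) +
     (r * A - \sum_(a in B) D R a - \sum_(a in R) D R a))) h.
  by ring.
rewrite dU dX dB dR e5 e6 e7 e3 e4 e1 e2 -/n -/r.
by field.
Qed.

End Partition.
End Sums.

(** * Elementary symmetric polynomials of the blue coordinates *)

Section RootPolynomial.
Variables (F : numFieldType) (N : nat) (e : 'I_N -> F).
Hypothesis e_inj : injective e.
Implicit Types (S : {set 'I_N}) (a b : 'I_N).

Definition site_poly S : {poly F} := \prod_(b in S) ('X - (e b)%:P).

Lemma site_poly_setD1 S a : a \in S -> site_poly S = ('X - (e a)%:P) * site_poly (S :\ a).
Proof. by move=> aS; rewrite /site_poly (big_setD1 a). Qed.

Lemma size_site_poly S : size (site_poly S) = #|S|.+1.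
Proof. by rewrite /site_poly -big_enum size_prod_XsubC -cardE. Qed.

Lemma deriv_site_poly S : (site_poly S)^`() = \sum_(a in S) site_poly (S :\ a).
Proof.
elim: {S}#|S| {-2}S (erefl #|S|) => [S /cards0_eq ->|n IH S Sn].
  by rewrite /site_poly !big_set0 -(polyC1 F) derivC.
have /card_gt0P [x xS] : (0 < #|S|)%N by rewrite Sn.
have Sx : #|S :\ x| = n by move: (cardsD1 x S); rewrite xS Sn => -[].
rewrite (site_poly_setD1 xS) derivM derivXsubC mul1r (IH _ Sx) [in RHS](big_setD1 x) //=.
congr (_ + _); rewrite mulr_sumr; apply: eq_bigr => a; rewrite !inE => /andP[ax aS].
rewrite (@site_poly_setD1 (S :\ a) x) ?inE 1?eq_sym ?ax //.
by rewrite !setDDl setUC.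
Qed.

(** Since the derivative of [site_poly S] in [e a] is minus [site_poly (S :\ a)], this is minus the
    Euler operator acting on a coefficient homogeneous of degree [#|S|] - m. *)
Lemma sum_e_coef S m :
  \sum_(a in S) e a * (site_poly (S :\ a))`_m = (m%:R - #|S|%:R) * (site_poly S)`_m.
Proof.
have h : \sum_(a in S) e a *: site_poly (S :\ a) = 'X * (site_poly S)^`() - #|S|%:R *:
  site_poly S.
  rewrite deriv_site_poly mulr_sumr scaler_nat -sumr_const -sumrB.
  apply: eq_bigr => a aS; rewrite (site_poly_setD1 aS) -mul_polyC; ring.
have := congr1 (fun p : {poly F} => p`_m) h.
rewrite coefB coefZ coefXM coef_deriv coef_sum.
under eq_bigr do rewrite coefZ.
move=> ->; case: m => [|m] /=; first by ring.
by rewrite -mulr_natr; ring.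
Qed.

(** Up to sign, the pair interaction of the Sutherland operator acting on one coefficient. Adding
    the terms (a, b) and (b, a) clears the denominator [e a - e b]: the pair contributes ['X^2 *
    site_poly (S :\ a :\ b) - site_poly S], and summation yields the second derivative of
    [site_poly S]. *)
Lemma sum_XS_coef S m :
  \sum_(a in S) XS e S a * (e a * (site_poly (S :\ a))`_m) =
  (m%:R * (m%:R - 1) - #|S|%:R * (#|S|%:R - 1)) / 2 * (site_poly S)`_m.
Proof.
pose f a b : {poly F} := (xx e a b * e a) *: site_poly (S :\ a).
pose P := \sum_(a in S) \sum_(b in S | b != a) f a b.
have h : P + P = 'X^2 * (site_poly S)^`()^`() - (#|S|%:R * (#|S|%:R - 1)) *: site_poly S.
  rewrite {2}/P sum_neq_swap -big_split /=.
  transitivity (\sum_(a in S) \sum_(b in S | b != a)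
     ('X^2 * site_poly (S :\ a :\ b) - site_poly S)).
    apply: eq_bigr => a aS; rewrite -big_split /=; apply: eq_bigr => b /andP[bS ba].
    rewrite /f (@site_poly_setD1 (S :\ a) b) ?inE ?ba //.
    rewrite (@site_poly_setD1 (S :\ b) a) ?inE 1?eq_sym ?ba // (site_poly_setD1 aS).
    rewrite (@site_poly_setD1 (S :\ a) b) ?inE ?ba //.
    have -> : S :\ b :\ a = S :\ a :\ b by rewrite !setDDl setUC.
    move: (site_poly _) => p.
    have hab : e a - e b != 0 by rewrite eB_neq0 // eq_sym.
    have hba : e b - e a != 0 by rewrite eB_neq0.
    transitivity (((xx e a b * e a + xx e b a * e b) *: 'X - (xx e a b * e a * e b + xx e
      b a * e b * e a)%:P) * p).
      rewrite -!mul_polyC !(polyCD, polyCM); ring.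
    have -> : xx e a b * e a + xx e b a * e b = e a + e b by rewrite /xx; field; rewrite
      hab hba.
    have -> : xx e a b * e a * e b + xx e b a * e b * e a = e a * e b by rewrite /xx;
      field; rewrite hab hba.
    by rewrite -mul_polyC polyCD polyCM; ring.
  rewrite deriv_site_poly (big_morph _ (@derivD F) (@deriv0 F)) mulr_sumr.
  rewrite -card_predr scaler_nat -(mulr_natl (site_poly S)) -sum_neq_card mulr_suml
    -sumrB.
  apply: eq_bigr => a aS; rewrite deriv_site_poly mulr_sumr mulr_suml sumrB.
  congr (_ - _).
    by apply: eq_bigl => b; rewrite !inE andbC.
  by apply: eq_bigr => b _; rewrite mul1r.
have := congr1 (fun p : {poly F} => p`_m) h.
rewrite coefD coefB coefZ coefXnM !coef_deriv.
have -> : P`_m = \sum_(a in S) XS e S a * (e a * (site_poly (S :\ a))`_m).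
  rewrite coef_sum; apply: eq_bigr => a _; rewrite coef_sum mulr_suml.
  by apply: eq_bigr => b _; rewrite coefZ mulrA.
move=> E; apply: (mulfI (_ : 2 != 0)); first by rewrite pnatr_eq0.
rewrite mulr_natl mulr2n E; case: m {E} => [|[|m]] /=; [by field|by field|].
rewrite subn2 /=.
have -> : (site_poly S)`_m.+2 *+ m.+2 *+ m.+1 = (site_poly S)`_m.+2 * ((m%:R + 2) * (m%:R
  + 1)).
  by rewrite -[_ *+ m.+1]mulr_natr -[_ *+ m.+2]mulr_natr -mulrA -[m.+2]addn2 -[m.+1]addn1
    !natrD.
by rewrite -[in RHS]addn2 natrD; field.
Qed.

Lemma e_coef S a m : a \in S ->
  e a * (site_poly (S :\ a))`_m = ('X * site_poly (S :\ a))`_m - (site_poly S)`_m.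
Proof.
move=> aS; rewrite -coefB (site_poly_setD1 aS).
have -> : 'X * site_poly (S :\ a) - ('X - (e a)%:P) * site_poly (S :\ a) = e a *:
  site_poly (S :\ a).
  by rewrite -mul_polyC; ring.
by rewrite coefZ.
Qed.

(* Induction on n through (m, n + 1) -> (m + 1, n): each step moves one power of X
   from one factor to the other by e_coef. *)
Lemma sum_e2_coef S m n :
  \sum_(a in S) e a ^+ 2 * ((site_poly (S :\ a))`_m * (site_poly (S :\ a))`_n) =
  (#|S|%:R - m%:R) * ((site_poly S)`_m * (site_poly S)`_n)
  - \sum_(1 <= l < n.+1) (m%:R - n%:R + 2 * l%:R) * ((site_poly S)`_(m + l) * (site_poly
    S)`_(n - l)).
Proof.
elim: n m => [|n IH] m.
  rewrite big_geq // subr0.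
  transitivity (- (site_poly S)`_0 * \sum_(a in S) e a * (site_poly (S :\ a))`_m).
    rewrite mulr_sumr; apply: eq_bigr => a aS.
    have := e_coef 0 aS; rewrite coefXM /= sub0r => <-; ring.
  by rewrite sum_e_coef; ring.
have -> : \sum_(a in S) e a ^+ 2 * ((site_poly (S :\ a))`_m * (site_poly (S :\ a))`_n.+1)
  =
  \sum_(a in S) e a ^+ 2 * ((site_poly (S :\ a))`_m.+1 * (site_poly (S :\ a))`_n)
  + (site_poly S)`_m.+1 * \sum_(a in S) e a * (site_poly (S :\ a))`_n
  - (site_poly S)`_n.+1 * \sum_(a in S) e a * (site_poly (S :\ a))`_m.
  rewrite !mulr_sumr -big_split -sumrB; apply: eq_bigr => a aS /=.
  have h1 := e_coef n.+1 aS; have h2 := e_coef m.+1 aS.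
  rewrite !coefXM /= in h1 h2.
  have -> : e a ^+ 2 * ((site_poly (S :\ a))`_m * (site_poly (S :\ a))`_n.+1) =
    e a * (site_poly (S :\ a))`_m * (e a * (site_poly (S :\ a))`_n.+1) by ring.
  have -> : e a ^+ 2 * ((site_poly (S :\ a))`_m.+1 * (site_poly (S :\ a))`_n) =
    e a * (site_poly (S :\ a))`_n * (e a * (site_poly (S :\ a))`_m.+1) by ring.
  by rewrite h1 h2; ring.
rewrite IH !sum_e_coef [in RHS]big_nat_recl //= addn1 subn1 /=.
have -> : \sum_(1 <= i < n.+1) (m%:R - n.+1%:R + 2 * i.+1%:R) * ((site_poly S)`_(m +
  i.+1) * (site_poly S)`_(n.+1 - i.+1))
  = \sum_(1 <= l < n.+1) (m.+1%:R - n%:R + 2 * l%:R) * ((site_poly S)`_(m.+1 + l) *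
    (site_poly S)`_(n - l)).
  apply: eq_bigr => l _; rewrite addnS addSn subSS; congr (_ * _).
  by rewrite -!natr1; ring.
by rewrite -!natr1; ring.
Qed.

End RootPolynomial.

(** * The action of the exchanges on sets of sites *)

Section GroundState.
Variables (F : numFieldType) (N : nat) (e : 'I_N -> F).
Hypothesis e_inj : injective e.
Hypothesis e_prod : \prod_(a < N) ('X - (e a)%:P) = 'X^N - 1.
Hypothesis e_pow : forall k : nat, (0 < k < N)%N -> \sum_(b < N) e b ^+ k = 0.
Implicit Types (S T B R U : {set 'I_N}) (a b x : 'I_N).

Local Notation site_poly := (site_poly e).
Local Notation XS := (XS e).
Local Notation QS := (QS e).
Local Notation c := (lattice_xx F N).

Definition sqdiff S : F := \prod_(a in S) \prod_(b in S | (a < b)%N) (e a - e b) ^+ 2.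

Definition crossdiff S T : F := \prod_(a in S) \prod_(b in T) (e a - e b).

Definition ground B R : F :=
  sqdiff B * sqdiff R * crossdiff B R * (\prod_(a in B) e a) * (\prod_(a in R) e a).

(* The amplitude ground as a function, up to a constant, of the coordinate of one
   particle, for S the other particles of its color and T those of the other color. *)
Definition hop_poly S T : {poly F} := 'X * (site_poly S * site_poly S) * site_poly T.

Lemma horner_site_poly S t : (site_poly S).[t] = \prod_(b in S) (t - e b).
Proof. by rewrite horner_prod; apply: eq_bigr => b _; rewrite hornerXsubC. Qed.

Lemma horner_site_poly_eq0 S a : a \in S -> (site_poly S).[e a] = 0.
Proof. by move=> aS; rewrite horner_site_poly (big_setD1 a) //= subrr mul0r. Qed.

Lemma horner_site_poly_neq0 S a : a \notin S -> (site_poly S).[e a] != 0.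
Proof.
move=> aS; rewrite horner_site_poly; apply/prodf_neq0 => b bS.
by apply: eB_neq0 => //; apply: contraNneq aS => ->.
Qed.

Lemma site_poly_setU1 S x : x \notin S -> site_poly (x |: S) = ('X - (e x)%:P) *
  site_poly S.
Proof. by move=> xS; rewrite /site_poly big_setU1. Qed.

Lemma sqdiff_setU1 S x : x \notin S -> sqdiff (x |: S) = sqdiff S * (site_poly S).[e x]
  ^+ 2.
Proof.
move=> xS; rewrite /sqdiff big_setU1 //= big_mkcondr big_setU1 //= ltnn mul1r.
rewrite [X in _ * X](eq_bigr (fun a => (if (a < x)%N then (e a - e x) ^+ 2 else 1)
   * \prod_(b in S | (a < b)%N) (e a - e b) ^+ 2)); last first.
  by move=> a aS; rewrite big_mkcondr big_setU1 //= -big_mkcondr.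
rewrite big_split /= mulrA -big_split /= mulrC horner_site_poly -prodrXl.
congr (_ * _); apply: eq_bigr => b bS.
have /negPf : b != x by apply: contraNneq xS => <-.
rewrite -val_eqE /=; case: ltngtP => // _ _; rewrite ?mul1r ?mulr1 //.
by rewrite -sqrrN opprB.
Qed.

Lemma ground_blue B R x : x \notin B -> ground (x |: B) R = ground B R * (hop_poly B
  R).[e x].
Proof.
move=> xB; rewrite /ground sqdiff_setU1 // /crossdiff !big_setU1 //= /hop_poly !hornerM
  hornerX.
by rewrite (horner_site_poly R); ring.
Qed.

(** The cross factors are blue minus red, whereas [hop_poly] evaluated at a red site gives red minus
    blue: one sign per blue site. *)
Lemma ground_red B R x : x \notin R ->
  ground B (x |: R) = ground B R * ((-1) ^+ #|B| * (hop_poly R B).[e x]).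
Proof.
move=> xR; rewrite /ground sqdiff_setU1 // !big_setU1 //= /hop_poly !hornerM hornerX.
have -> : crossdiff B (x |: R) = (-1) ^+ #|B| * (site_poly B).[e x] * crossdiff B R.
  rewrite /crossdiff horner_site_poly -prodr_const -!big_split /=; apply: eq_bigr => a _.
  by rewrite big_setU1 //=; ring.
by ring.
Qed.

Lemma sqdiff_neq0 S : sqdiff S != 0.
Proof.
apply/prodf_neq0 => a _; apply/prodf_neq0 => b /andP[_ ab].
by rewrite expf_neq0 // eB_neq0 // -val_eqE /= neq_ltn ab.
Qed.

Lemma ground_neq0 B R : [disjoint B & R] -> ground B R != 0.
Proof.
move=> dBR; rewrite /ground !mulf_neq0 ?sqdiff_neq0 //.
- apply/prodf_neq0 => a aB; apply/prodf_neq0 => b bR.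
  by rewrite eB_neq0 // eq_sym (disjoint_neq dBR aB bR).
- by apply/prodf_neq0 => a _; apply: e_neq0 e_prod a.
- by apply/prodf_neq0 => a _; apply: e_neq0 e_prod a.
Qed.

Lemma horner_hop_poly_neq0 S T a : a \notin S -> a \notin T -> (hop_poly S T).[e a] != 0.
Proof.
move=> aS aT; rewrite /hop_poly !hornerM hornerX !mulf_neq0 ?horner_site_poly_neq0 //.
exact: e_neq0 e_prod a.
Qed.

Lemma horner_hop_poly_eq0 S T a : (a \in S) || (a \in T) -> (hop_poly S T).[e a] = 0.
Proof.
by rewrite /hop_poly !hornerM => /orP[] h; rewrite (horner_site_poly_eq0 h) ?(mul0r,
  mulr0).
Qed.

Lemma log_derivs_site_poly S a : a \notin S -> log_derivs (site_poly S) (e a) (XS S a)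
  (QS S a).
Proof.
move=> aS; have -> : XS S a = \sum_(b in S) e a / (e a - e b).
  apply: eq_bigl => b; case bS: (b \in S) => //=; apply/eqP => ba.
  by rewrite -ba bS in aS.
have -> : QS S a = \sum_(b in S) (e a / (e a - e b)) ^+ 2.
  apply: eq_bigl => b; case bS: (b \in S) => //=; apply/eqP => ba.
  by rewrite -ba bS in aS.
apply: log_derivs_prod => b bS; rewrite -subr_eq0 eB_neq0 //.
by apply: contraNneq aS => ->.
Qed.

Lemma log_derivs_hop_poly S T a : a \notin S -> a \notin T ->
  log_derivs (hop_poly S T) (e a) (1 + 2 * XS S a + XS T a) (1 + 2 * QS S a + QS T a).
Proof.
move=> aS aT; rewrite !(mulr_natl _ 2) !mulr2n.
apply: log_derivsM; last exact: log_derivs_site_poly.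
apply: log_derivsM; last by apply: log_derivsM; exact: log_derivs_site_poly.
exact: log_derivsX.
Qed.

Lemma size_hop_poly S T : (size (hop_poly S T) <= (2 * #|S| + #|T|).+2)%N.
Proof.
rewrite /hop_poly; apply: leq_trans (size_polyMleq _ _) _; rewrite size_site_poly addnS
  /=.
rewrite -[X in (_ <= X)%N]/((2 * #|S|).+2 + #|T|)%N leq_add2r.
apply: leq_trans (size_polyMleq _ _) _; rewrite size_polyX /=.
rewrite ltnS; apply: leq_trans (size_polyMleq _ _) _; by rewrite size_site_poly addSn /=
  addnS mul2n -addnn.
Qed.

(** Leibniz rule in [hop_sum]: the derivatives of [hop_poly] enter only through [l] and [q], so its
    value factors out and an operator on [G] remains. The size hypothesis keeps the product within
    degree N. *)
Lemma hop_hop_poly S T a (G : {poly F}) : a \notin S -> a \notin T ->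
  (size G + (2 * #|S| + #|T|) <= N)%N ->
  let l := 1 + 2 * XS S a + XS T a in let q := 1 + 2 * QS S a + QS T a in
  \sum_(b < N | b != a) dinv e a b * (G * hop_poly S T).[e b] =
  (hop_poly S T).[e a] * (hop_const N l q * G.[e a] + (l - c) * (e a * G^`().[e a])
     + e a ^+ 2 * G^`()^`().[e a] / 2).
Proof.
move=> aS aT sz l q; rewrite hop_sum //; last first.
  apply: leq_trans (size_polyMleq _ _) _; have := size_hop_poly S T; lia.
have [h1 h2] := log_derivs_hop_poly aS aT; rewrite -/l -/q in h1 h2.
move: (hop_poly S T) h1 h2 => P h1 h2.
rewrite !(derivM, derivD) !(hornerM, hornerD) /hop_const.
move: h1 h2; set p := P.[e a]; set p1 := P^`().[e a].
set p2 := P^`()^`().[e a] => h1 h2.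
transitivity (lattice_dinv F N * (G.[e a] * p) - c * (e a * G^`().[e a] * p + G.[e a] *
  (e a * p1))
  + (e a ^+ 2 * G^`()^`().[e a] * p + 2 * (e a * G^`().[e a]) * (e a * p1) + G.[e a] * (e
    a ^+ 2 * p2)) / 2).
  by field.
by rewrite h1 h2; field.
Qed.

(** The derivative of ['X^N - 1] at [e a]. This relation is what trades red coordinates for green
    ones below. *)
Lemma prod_neq_root a : (site_poly (setT :\ a)).[e a] * e a = N%:R.
Proof.
have E : ('X - (e a)%:P) * site_poly (setT :\ a) = 'X^N - 1.
  by rewrite -(@site_poly_setD1 _ _ e setT) ?inE // -e_prod; apply: eq_bigl => b; rewrite
    inE.
have : (('X - (e a)%:P) * site_poly (setT :\ a))^`().[e a] = (site_poly (setT :\ a)).[e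
  a].
  by rewrite derivM derivXsubC mul1r hornerD hornerM hornerXsubC subrr mul0r addr0.
move=> <-; rewrite E derivB derivXn (derivC 1) subr0 hornerMn hornerXn mulrnAl.
by rewrite -exprSr prednK ?(eN e_prod) //; case: (a) => i; case: (N).
Qed.

(* Complementation in the lattice trades the red coordinates for the green
   ones, up to a constant, so the blue-red exchange moves a blue particle by
   the same rule as the blue-green exchange. *)
Lemma ground_exchange B R U a b :
  [disjoint B & R] -> [disjoint B & U] -> [disjoint R & U] ->
  B :|: R :|: U = setT -> a \in B -> b \in R ->
  ground (b |: B :\ a) (a |: R :\ b) * (hop_poly (B :\ a) U).[e a] =
  ground B R * (hop_poly (B :\ a) U).[e b].
Proof.
move=> dBR dBU dRU cBRU aB bR.
have ab : b != a := disjoint_neq dBR aB bR.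
have aR : a \notin R by rewrite (disjointFr dBR aB).
have bB : b \notin B by rewrite (disjointFl dBR bR).
have aU : a \notin U by rewrite (disjointFr dBU aB).
have bU : b \notin U by rewrite (disjointFr dRU bR).
have aB' : a \notin B :\ a by rewrite !inE eqxx.
have bR' : b \notin R :\ b by rewrite !inE eqxx.
have bB' : b \notin B :\ a by rewrite !inE negb_and bB orbT.
have aR' : a \notin R :\ b by rewrite !inE negb_and aR orbT.
have full y : y \in B :|: R :|: U by rewrite cBRU inE.
(* All sites other than s are the remaining blue and red ones, the green ones and the exchange
   partner t, so the product over them fixes the red factor at s in terms of the others. *)
have hU s t : (s == a) && (t == b) || (s == b) && (t == a) ->
    (site_poly (B :\ a)).[e s] * (site_poly (R :\ b)).[e s] * (site_poly U).[e s] * (e s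
      - e t) * e s = N%:R.
  move=> hst; rewrite -(prod_neq_root s); congr (_ * _).
  have -> : setT :\ s = t |: ((B :\ a) :|: (R :\ b) :|: U).
    apply/setP => y; have := full y; rewrite !inE.
    case/orP: hst => /andP[/eqP -> /eqP ->]; rewrite andbT.
      case: (eqVneq y a) => [->|ya]; first by rewrite (negPf aR) (negPf aU) !orbF andbF
        orbF eq_sym (negPf ab).
      by case: (y == b).
    case: (eqVneq y b) => [->|yb]; first by rewrite (negPf bB) (negPf bU) (negPf ab)
      !(andbF, orbF).
    by case: (y == a).
  have tn : t \notin (B :\ a) :|: (R :\ b) :|: U.
    by case/orP: hst => /andP[_ /eqP ->]; rewrite in_setU in_setU ?(negPf aB') ?(negPf
      aR') ?(negPf aU) ?(negPf bB') ?(negPf bR') ?(negPf bU).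
  rewrite site_poly_setU1 // hornerM hornerXsubC mulrC; congr (_ * _).
  rewrite !horner_site_poly !(big_mkcond (fun y => y \in _)) -!big_split /=.
  apply: eq_bigr => y _; rewrite !inE.
  have := full y; rewrite !inE.
  case yB: (y \in B).
    by rewrite (disjointFr dBR yB) (disjointFr dBU yB) andbF !orbF !mulr1.
  case yR: (y \in R).
    by rewrite (disjointFr dRU yR) andbF !orbF !mulr1 mul1r.
  by rewrite !andbF /= => ->; rewrite !mul1r.
have hA : (site_poly (B :\ a)).[e a] * (site_poly (R :\ b)).[e a] * (site_poly U).[e a] *
  (e a - e b) * e a = N%:R.
  by apply: hU; rewrite !eqxx.
have hB : (site_poly (B :\ a)).[e b] * (site_poly (R :\ b)).[e b] * (site_poly U).[e b] *
  (e b - e a) * e b = N%:R.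
  by apply: hU; rewrite !eqxx orbT.
rewrite -{3}(setD1K aB) -{2}(setD1K bR) !ground_blue // !ground_red //.
rewrite /hop_poly !hornerM !hornerX !site_poly_setU1 // !hornerM !hornerXsubC.
move: hA hB; move: (site_poly _).[_] (site_poly _).[_] (site_poly _).[_] (site_poly
  _).[_] (site_poly _).[_] (site_poly _).[_].
move=> v1 v2 v3 v4 v5 v6 hA hB.
(* Both sides are the same monomial times one of the products in [hA] and [hB], and each of these
   equals N. *)
pose K := ground (B :\ a) (R :\ b) * (-1) ^+ #|B :\ a|; transitivity (- (K * (e a * e b *
  v2 * v3 ^+ 2 * v5 * v6 ^+ 2)) * N%:R).
  by rewrite -hA /K; ring.
by rewrite -hB /K; ring.
Qed.

Definition amp (m n : nat) B R : F := (site_poly B)`_m * (site_poly B)`_n * ground B R.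

(* Coefficient m for S and one more particle, as a function of the coordinate of
   that particle. *)
Definition lin_coef S m : {poly F} := (('X * site_poly S)`_m)%:P - (site_poly S)`_m *: 'X.

Lemma lin_coefE S m b : b \notin S -> (lin_coef S m).[e b] = (site_poly (b |: S))`_m.
Proof.
move=> bS; rewrite site_poly_setU1 // mulrBl coefB coefCM /lin_coef.
by rewrite hornerD hornerN hornerC hornerZ hornerX; ring.
Qed.

Lemma deriv_lin_coef S m : (lin_coef S m)^`() = - ((site_poly S)`_m)%:P.
Proof. by rewrite /lin_coef derivB derivC derivZ derivX sub0r alg_polyC. Qed.

Lemma size_lin_coef S m : (size (lin_coef S m) <= 2)%N.
Proof.
rewrite (leq_trans (size_polyD _ _)) // geq_max.
rewrite (leq_trans (size_polyC_leq1 _)) // size_polyN.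
by rewrite (leq_trans (size_scale_leq _ _)) // size_polyX.
Qed.

Definition pair_coef S m n : {poly F} := lin_coef S m * lin_coef S n.

Lemma size_pair_coef S m n : (size (pair_coef S m n) <= 3)%N.
Proof.
rewrite (leq_trans (size_polyMleq _ _)) //.
have := size_lin_coef S m; have := size_lin_coef S n.
by case: (size _) => [|[|[|]]] //; case: (size _) => [|[|[|]]].
Qed.

Lemma XS_setD1 S a : XS (S :\ a) a = XS S a.
Proof. by apply: eq_bigl => b; rewrite !inE; case: eqP; rewrite ?andbF. Qed.

Lemma QS_setD1 S a : QS (S :\ a) a = QS S a.
Proof. by apply: eq_bigl => b; rewrite !inE; case: eqP; rewrite ?andbF. Qed.

Section Action.
Variables B R U : {set 'I_N}.
Hypothesis dBR : [disjoint B & R].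
Hypothesis dBU : [disjoint B & U].
Hypothesis dRU : [disjoint R & U].
Hypothesis cBRU : B :|: R :|: U = setT.

Lemma in_partition a : (a \in B) || (a \in R) || (a \in U).
Proof. by have := in_setT a; rewrite -cBRU !inE. Qed.

Lemma restrict_sum S a (f : 'I_N -> F) : a \notin S ->
  (forall b, b != a -> b \notin S -> f b = 0) ->
  \sum_(b in S) f b = \sum_(b < N | b != a) f b.
Proof.
move=> aS f0; rewrite [RHS](bigID (mem S)) /= [X in _ + X]big1 => [|b /andP[] //].
  rewrite addr0; apply: eq_bigl => b; case bS: (b \in S); rewrite ?andbF //.
  by apply/esym/andP; split=> //; apply: contraNneq aS => <-.
by move=> ba bS; apply: f0.
Qed.

Lemma blue_green_sum a m n : a \in B -> (3 + (2 * #|B :\ a| + #|R|) <= N)%N ->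
  let l := 1 + 2 * XS B a + XS R a in let q := 1 + 2 * QS B a + QS R a in
  let G := pair_coef (B :\ a) m n in
  \sum_(b in U) dinv e a b * amp m n (b |: B :\ a) R =
  ground B R * (hop_const N l q * G.[e a] + (l - c) * (e a * G^`().[e a])
     + e a ^+ 2 * G^`()^`().[e a] / 2).
Proof.
move=> aB sz l q G.
have aR : a \notin R by rewrite (disjointFr dBR aB).
have aU : a \notin U by rewrite (disjointFr dBU aB).
have aB' : a \notin B :\ a by rewrite !inE eqxx.
transitivity (\sum_(b in U) ground (B :\ a) R * (dinv e a b * (G * hop_poly (B :\ a)
  R).[e b])).
  apply: eq_bigr => b bU.
  have bB : b \notin B :\ a by rewrite !inE negb_and (disjointFl dBU bU) orbT.
  by rewrite /amp ground_blue // -!lin_coefE // /G /pair_coef !hornerM; ring.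
(* The zeros of [hop_poly] at the blue and red sites extend the sum over green sites to all sites
   other than a, as [hop_sum] requires. *)
rewrite -mulr_sumr (restrict_sum aU); last first.
  move=> b ba bU; rewrite hornerM horner_hop_poly_eq0 ?mulr0 // !inE ba /=.
  by have := in_partition b; rewrite (negPf bU) orbF.
rewrite hop_hop_poly //; last by rewrite (leq_trans _ sz) // leq_add2r size_pair_coef.
have E : ground B R = ground (B :\ a) R * (hop_poly (B :\ a) R).[e a].
  by rewrite -ground_blue // setD1K.
by rewrite !XS_setD1 !QS_setD1 E; exact: mulrA.
Qed.

Lemma blue_red_sum a m n : a \in B -> (3 + (2 * #|B :\ a| + #|U|) <= N)%N ->
  let l := 1 + 2 * XS B a + XS U a in let q := 1 + 2 * QS B a + QS U a in
  let G := pair_coef (B :\ a) m n in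
  \sum_(b in R) dinv e a b * amp m n (b |: B :\ a) (a |: R :\ b) =
  ground B R * (hop_const N l q * G.[e a] + (l - c) * (e a * G^`().[e a])
     + e a ^+ 2 * G^`()^`().[e a] / 2).
Proof.
move=> aB sz l q G.
have aR : a \notin R by rewrite (disjointFr dBR aB).
have aU : a \notin U by rewrite (disjointFr dBU aB).
have aB' : a \notin B :\ a by rewrite !inE eqxx.
have p0 : (hop_poly (B :\ a) U).[e a] != 0 by apply: horner_hop_poly_neq0.
(* By [ground_exchange] the exchanged amplitude is a ratio of values of one polynomial with [U] in
   the place of [R], so the red particle that moves back to a needs no separate treatment. *)
transitivity (\sum_(b in R) ground B R / (hop_poly (B :\ a) U).[e a] * (dinv e a b * (G *
  hop_poly (B :\ a) U).[e b])).
  apply: eq_bigr => b bR.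
  have bB : b \notin B :\ a by rewrite !inE negb_and (disjointFl dBR bR) orbT.
  have h := ground_exchange dBR dBU dRU cBRU aB bR.
  rewrite /amp -!lin_coefE // (hornerM G) (hornerM (lin_coef (B :\ a) m)).
  have -> : ground (b |: B :\ a) (a |: R :\ b) = ground B R * (hop_poly (B :\ a) U).[e b]
    / (hop_poly (B :\ a) U).[e a].
    by rewrite -h mulfK.
  by field.
rewrite -mulr_sumr (restrict_sum aR); last first.
  move=> b ba bR; rewrite hornerM horner_hop_poly_eq0 ?mulr0 // !inE ba /=.
  by have := in_partition b; rewrite (negPf bR) orbF.
rewrite hop_hop_poly //; last by rewrite (leq_trans _ sz) // leq_add2r size_pair_coef.
by rewrite !XS_setD1 !QS_setD1 [LHS]mulrA (divfK p0).
Qed.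

(** The coefficients of [site_poly B] do not feel a red move, so [hop_hop_poly] applies with G = 1
    and only its zeroth-order term survives. *)
Lemma red_green_sum a m n : a \in R -> (1 + (2 * #|R :\ a| + #|B|) <= N)%N ->
  let l := 1 + 2 * XS R a + XS B a in let q := 1 + 2 * QS R a + QS B a in
  \sum_(b in U) dinv e a b * amp m n B (b |: R :\ a) =
  amp m n B R * hop_const N l q.
Proof.
move=> aR sz l q.
have aB : a \notin B by rewrite (disjointFl dBR aR).
have aU : a \notin U by rewrite (disjointFr dRU aR).
have aR' : a \notin R :\ a by rewrite !inE eqxx.
transitivity (\sum_(b in U) (site_poly B)`_m * (site_poly B)`_n * (ground B (R :\ a) *
  (-1) ^+ #|B|) *
    (dinv e a b * (1 * hop_poly (R :\ a) B).[e b])).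
  apply: eq_bigr => b bU.
  have bR : b \notin R :\ a by rewrite !inE negb_and (disjointFl dRU bU) orbT.
  by rewrite /amp ground_red // mul1r; ring.
rewrite -mulr_sumr (restrict_sum aU); last first.
  move=> b ba bU; rewrite mul1r horner_hop_poly_eq0 ?mulr0 // !inE ba /=.
  by have := in_partition b; rewrite (negPf bU) orbF orbC.
rewrite hop_hop_poly //; last by rewrite size_poly1.
have E : ground B R = ground B (R :\ a) * ((-1) ^+ #|B| * (hop_poly (R :\ a) B).[e a]).
  by rewrite -ground_red // setD1K.
rewrite /amp !XS_setD1 !QS_setD1 E -(polyC1 F) derivC derivC !hornerC -/l -/q.
by ring.
Qed.
End Action.
End GroundState.

(** * The full exchange operator on an amplitude *)

Section SetLevel.
Variables (F : numFieldType) (N : nat) (e : 'I_N -> F).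
Hypothesis e_inj : injective e.
Hypothesis e_prod : \prod_(a < N) ('X - (e a)%:P) = 'X^N - 1.
Hypothesis e_pow : forall k : nat, (0 < k < N)%N -> \sum_(b < N) e b ^+ k = 0.

Variables (B R U : {set 'I_N}) (M1 : nat).
Hypothesis dBR : [disjoint B & R].
Hypothesis dBU : [disjoint B & U].
Hypothesis dRU : [disjoint R & U].
Hypothesis cBRU : B :|: R :|: U = setT.
Hypothesis cardB : #|B| = M1.
Hypothesis cardR : #|R| = M1.+2.
Hypothesis NE : N = (3 * M1 + 4)%N.

Local Notation XS := (XS e).
Local Notation QS := (QS e).
Local Notation DS := (DS e).
Local Notation amp := (amp e).
Local Notation dinv := (dinv e).
Local Notation c := (lattice_xx F N).

(** Green sites are as many as red ones, so the blue-red hop obeys the same degree bound as the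
    blue-green hop. *)
Lemma card_green : #|U| = M1.+2.
Proof.
have := card_partition F dBR dBU dRU cBRU.
rewrite -!natrD => /eqP; rewrite eqr_nat cardB cardR => /eqP; have := NE.
set k := #|U|; lia.
Qed.

Lemma NrE : N%:R = 3 * M1%:R + 4 :> F.
Proof. by rewrite NE natrD natrM. Qed.

(* The Calogero-Sutherland operator acting on a product of two elementary
   symmetric polynomials of the blue coordinates. *)
Lemma sutherland_sum m n :
  let G a := pair_coef e (B :\ a) m n in
  \sum_(a in B) (e a * (G a)^`().[e a] * (2 - c + 3 * XS B a)
    + e a ^+ 2 * (G a)^`()^`().[e a]) =
  (c - 2) * (m%:R + n%:R - 2 * M1%:R) * ((site_poly e B)`_m * (site_poly e B)`_n)
  - 3 / 2 * (m%:R * (m%:R - 1) + n%:R * (n%:R - 1) - 2 * (M1%:R * (M1%:R - 1)))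
     * ((site_poly e B)`_m * (site_poly e B)`_n)
  + 2 * ((M1%:R - m%:R) * ((site_poly e B)`_m * (site_poly e B)`_n)
     - \sum_(1 <= l < n.+1) (m%:R - n%:R + 2 * l%:R) *
         ((site_poly e B)`_(m + l) * (site_poly e B)`_(n - l))).
Proof.
move=> G.
have h1m := sum_e_coef e B m; have h1n := sum_e_coef e B n.
have h2m := sum_XS_coef e_inj B m; have h2n := sum_XS_coef e_inj B n.
have h3 := sum_e2_coef e B m n; rewrite cardB in h1m h1n h2m h2n h3.
(* Each [lin_coef] is affine with slope minus a coefficient of [site_poly e (B :\ a)], so the second
   derivative of the product is twice the product of the slopes. *)
transitivity ((c - 2) * ((\sum_(a in B) e a * (site_poly e (B :\ a))`_m) * (site_poly e
  B)`_n
      + (\sum_(a in B) e a * (site_poly e (B :\ a))`_n) * (site_poly e B)`_m)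
   - 3 * ((\sum_(a in B) XS B a * (e a * (site_poly e (B :\ a))`_m)) * (site_poly e B)`_n
      + (\sum_(a in B) XS B a * (e a * (site_poly e (B :\ a))`_n)) * (site_poly e B)`_m)
   + 2 * \sum_(a in B) e a ^+ 2 * ((site_poly e (B :\ a))`_m * (site_poly e (B :\
     a))`_n)); last first.
  by rewrite h1m h1n h2m h2n h3; field.
rewrite !mulr_suml -!big_split /= !mulr_sumr -sumrB -big_split /=.
apply: eq_bigr => a aB.
have aB' : a \notin B :\ a by rewrite !inE eqxx.
have pE k : (lin_coef e (B :\ a) k).[e a] = (site_poly e B)`_k by rewrite lin_coefE //
  setD1K.
rewrite /G /pair_coef; have := pE m; have := pE n.
have := deriv_lin_coef e (B :\ a) m; have := deriv_lin_coef e (B :\ a) n.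
move: (lin_coef _ _ m) (lin_coef _ _ n) => p q dq dp qE {}pE.
rewrite !(derivM, derivD, dp, dq, derivN, derivC).
rewrite !(hornerD, hornerM, hornerN, hornerC) pE qE.
by ring.
Qed.

(** The left side is the Hamiltonian without its prefactor: pairs of different colors, then pairs of
    equal color, then the subtracted constant. The latter is 1/3 of the total weight of all pairs, N
    A / 2, whence the 6. *)
Lemma amp_action m n :
  \sum_(a in B) \sum_(b in U) dinv a b * amp m n (b |: B :\ a) R
  + \sum_(a in B) \sum_(b in R) dinv a b * amp m n (b |: B :\ a) (a |: R :\ b)
  + \sum_(a in R) \sum_(b in U) dinv a b * amp m n B (b |: R :\ a)
  + (\sum_(a in B) DS B a + \sum_(a in R) DS R a + \sum_(a in U) DS U a) / 2
      * amp m n B R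
  - N%:R * lattice_dinv F N / 6 * amp m n B R =
  (- (N%:R ^+ 2 / 36 * (N%:R - 17 / N%:R + 52 / N%:R ^+ 2))
   + 3 / 2 * ((M1%:R - m%:R) * m%:R + (M1%:R - n%:R) * n%:R - 2 / 3 * (m%:R - n%:R)))
     * amp m n B R
  - 2 * \sum_(1 <= l < n.+1) (m%:R - n%:R + 2 * l%:R) * amp (m + l) (n - l) B R.
Proof.
have szB a (T : {set 'I_N}) : a \in B -> #|T| = M1.+2 -> (3 + (2 * #|B :\ a| + #|T|) <=
  N)%N.
  move=> aB ->; have := cardsD1 a B; rewrite aB cardB; have := NE.
  set k := #|_ :\ _|; lia.
have szR a : a \in R -> (1 + (2 * #|R :\ a| + #|B|) <= N)%N.
  move=> aR; have := cardsD1 a R; rewrite aR cardB cardR; have := NE.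
  set k := #|_ :\ _|; lia.
set V := \sum_(1 <= l < n.+1) _.
have VE : V = (\sum_(1 <= l < n.+1) (m%:R - n%:R + 2 * l%:R) *
         ((site_poly e B)`_(m + l) * (site_poly e B)`_(n - l))) * ground e B R.
  by rewrite mulr_suml; apply: eq_bigr => l _; rewrite /amp mulrA.
rewrite (eq_bigr _ (fun a aB => blue_green_sum e_inj e_prod e_pow dBR dBU cBRU m n aB
  (szB a R aB cardR))).
rewrite [X in _ + X + _ + _ - _](eq_bigr _ (fun a aB => blue_red_sum e_inj e_prod e_pow
  dBR dBU dRU cBRU m n aB (szB a U aB card_green))).
rewrite [X in _ + X + _ - _](eq_bigr _ (fun a aR => red_green_sum e_inj e_prod e_pow dBR
  dRU cBRU m n aR (szR a aR))).
have C := constant_sum e_inj e_prod dBR dBU dRU cBRU.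
have S := sutherland_sum m n.
have G0 a : a \in B -> (pair_coef e (B :\ a) m n).[e a] = (site_poly e B)`_m * (site_poly
  e B)`_n.
  by move=> aB; rewrite hornerM !lin_coefE ?setD1K // !inE eqxx.
rewrite -!mulr_sumr.
(* Only the sum of the two blue exchanges is free of [XS R] and [XS U] at first order. The
   blue-green part is therefore rewritten as the Sutherland operator plus constants minus the
   blue-red part, which then cancels. *)
have -> : \sum_(a in B) (hop_const N (1 + 2 * XS B a + XS R a) (1 + 2 * QS B a + QS R a)
       * (pair_coef e (B :\ a) m n).[e a] + (1 + 2 * XS B a + XS R a - c) * (e a *
         (pair_coef e (B :\ a) m n)^`().[e a])
       + e a ^+ 2 * (pair_coef e (B :\ a) m n)^`()^`().[e a] / 2) =
  (\sum_(a in B) (hop_const N (1 + 2 * XS B a + XS R a) (1 + 2 * QS B a + QS R a)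
     + hop_const N (1 + 2 * XS B a + XS U a) (1 + 2 * QS B a + QS U a)))
   * ((site_poly e B)`_m * (site_poly e B)`_n)
  + \sum_(a in B) (e a * (pair_coef e (B :\ a) m n)^`().[e a] * (2 - c + 3 * XS B a)
    + e a ^+ 2 * (pair_coef e (B :\ a) m n)^`()^`().[e a])
  - \sum_(a in B) (hop_const N (1 + 2 * XS B a + XS U a) (1 + 2 * QS B a + QS U a)
       * (pair_coef e (B :\ a) m n).[e a] + (1 + 2 * XS B a + XS U a - c) * (e a *
         (pair_coef e (B :\ a) m n)^`().[e a])
       + e a ^+ 2 * (pair_coef e (B :\ a) m n)^`()^`().[e a] / 2).
  rewrite mulr_suml -big_split -sumrB; apply: eq_bigr => a aB; rewrite G0 //=.
  have -> : XS U a = c - XS B a - XS R a.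
    by rewrite -(XS_partition e_inj e_prod dBR dBU dRU cBRU a); ring.
  by field.
rewrite S {S} VE.
move: C; rewrite cardB cardR.
set C1 := \sum_(a in B) _; set C2 := \sum_(a in R) hop_const _ _ _.
set C3 := (\sum_(a in B) DS B a + _ + _) / 2; set T := \sum_(a in B) _; set W := \sum_(1
  <= l < _) _.
move=> C.
have -> : C1 = C1 + C2 + C3 - C2 - C3 by ring.
rewrite C /amp /lattice_dinv /lattice_xx.
have N0 : N%:R != 0 :> F by rewrite pnatr_eq0 NE addn4.
have -> : (M1.+2%:R = M1%:R + 2 :> F) by rewrite -[M1.+2]addn2 natrD.
move: N0; rewrite NrE => N0; field.
by [].
Qed.

End SetLevel.

Local Open Scope complex_scope.

(** * The states *)

Section RootsOfUnity.
Variables (R : realType).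
Implicit Types (x y : R).

Definition expi x : R[i] := cos x +i* sin x.

Lemma expiD x y : expi (x + y) = expi x * expi y.
Proof.
rewrite /expi cosD sinD; apply/eqP; rewrite eq_complex /=.
by apply/andP; split; apply/eqP; ring.
Qed.

Lemma expi0 : expi 0 = 1.
Proof. by rewrite /expi cos0 sin0. Qed.

Lemma expi_mulrn x n : expi (x *+ n) = expi x ^+ n.
Proof. by elim: n => [|n IH]; rewrite ?mulr0n ?expi0 // mulrS expiD IH exprS. Qed.

Lemma expi_conj x : (expi x)^*%R = expi (- x).
Proof. by rewrite /expi cosN sinN. Qed.

Variable N : nat.
Hypothesis N_gt0 : (0 < N)%N.

Definition omega : R[i] := expi (2 * pi / N%:R).

Lemma etaE (a : 'I_N) : eta R a = omega ^+ a.+1.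
Proof.
rewrite /omega -expi_mulrn /eta.
have -> : 2 * pi * a.+1%:R / N%:R = (2 * pi / N%:R) *+ a.+1 :> R.
  by rewrite -[RHS]mulr_natr mulrAC.
by [].
Qed.

Lemma omegaN : omega ^+ N = 1.
Proof.
rewrite /omega -expi_mulrn -[_ *+ N]mulr_natr divfK ?pnatr_eq0 -?lt0n //.
by rewrite /expi mulr_natl cos2pi sin2pi.
Qed.

(** If the order m were less than N, then cos (2 pi m / N) = 1 would force sin (pi m / N) = 0,
    although pi m / N lies strictly between 0 and pi. *)
Lemma omega_prim : N.-primitive_root omega.
Proof.
have [m prim_m mN] := prim_order_exists N_gt0 omegaN.
have m_gt0 := prim_order_gt0 prim_m.
have := dvdn_leq N_gt0 mN; rewrite leq_eqVlt => /orP[/eqP <- //|ltmN].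
have := prim_expr_order prim_m; rewrite /omega -expi_mulrn => /(congr1 (@complex.Re R))
  /=.
have N0 : 0 < N%:R :> R by rewrite ltr0n.
have m0 : 0 < m%:R :> R by rewrite ltr0n.
have mN' : m%:R < N%:R :> R by rewrite ltr_nat.
have -> : 2 * pi / N%:R *+ m = (pi * (m%:R / N%:R)) *+ 2 :> R.
  by rewrite -mulr_natr -[RHS]mulr_natr; field; rewrite gt_eqF.
have hs : 0 < sin (pi * (m%:R / N%:R) : R).
  apply: sin_gt0_pi; rewrite mulr_gt0 ?pi_gt0 ?divr_gt0 //=.
  by rewrite -[ltRHS]mulr1 ltr_pM2l ?pi_gt0 // ltr_pdivrMr // mul1r.
rewrite cos_mulr2n cos2sin2; move: (sin _) hs => s hs h.
exfalso; have : 0 < s ^+ 2 by rewrite exprn_gt0.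
by move: h; rewrite mulr2n; lra.
Qed.

Lemma eta_inj : injective (@eta R N).
Proof.
move=> a b; rewrite !etaE => /eqP; rewrite (eq_prim_root_expr omega_prim).
rewrite -[a.+1]addn1 -[b.+1]addn1 eqn_modDr !modn_small // => /eqP ab.
exact: val_inj.
Qed.

Lemma eta_prod : \prod_(a < N) ('X - (eta R a)%:P) = 'X^N - 1.
Proof.
rewrite -(factor_Xn_sub_1 omega_prim).
transitivity (\prod_(a < N) ('X - (omega ^+ a.+1)%:P)).
  by apply: eq_bigr => a _; rewrite etaE.
rewrite -(big_mkord xpredT (fun i => 'X - (omega ^+ i.+1)%:P)).
rewrite -(prednK N_gt0) big_nat_recr // [RHS]big_nat_recl //= prednK // omegaN expr0.
exact: mulrC.
Qed.

Lemma eta_pow k : (0 < k < N)%N -> \sum_(b < N) eta R b ^+ k = 0.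
Proof.
move=> /andP[k0 kN].
have h : omega ^+ k - 1 != 0.
  rewrite subr_eq0 -(prim_order_dvd omega_prim); apply/negP => /(dvdn_leq k0).
  by rewrite leqNgt kN.
apply: (mulfI h); rewrite mulr0.
transitivity (omega ^+ k * ((omega ^+ k - 1) * \sum_(b < N) (omega ^+ k) ^+ b)).
  rewrite [RHS]mulrCA; congr (_ * _); rewrite mulr_sumr; apply: eq_bigr => b _.
  by rewrite etaE -exprS -!exprM mulnC.
by rewrite -subrX1 exprAC omegaN expr1n subrr mulr0.
Qed.

Lemma eta_conj (a : 'I_N) : (eta R a)^*%R = (eta R a)^-1.
Proof.
have h : eta R a * (eta R a)^*%R = 1.
  by rewrite -[eta R a]/(expi _) expi_conj -expiD subrr expi0.
have e0 : eta R a != 0.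
  by apply: contra_eq_neq h => ->; rewrite mul0r eq_sym oner_eq0.
by apply: (mulfI e0); rewrite h mulfV.
Qed.

Lemma eta_dist (a b : 'I_N) : a != b ->
  (`|eta R a - eta R b| ^+ 2)^-1 = dinv (@eta R N) a b.
Proof.
move=> ab; rewrite (dinv_sq eta_inj ab) normCK rmorphB /= !eta_conj.
have a0 := e_neq0 eta_prod a; have b0 := e_neq0 eta_prod b.
have h := eB_neq0 eta_inj ab.
have ba : b != a by rewrite eq_sym.
have h' := eB_neq0 eta_inj ba.
by field; rewrite a0 b0 h mulN1r h'.
Qed.

(** Discrete Fourier inversion. With degree below N there is no aliasing: distinct exponents i and m
    are incongruent modulo N. *)
Lemma eta_coef (p : {poly R[i]}) m : (m < N)%N -> (size p <= N)%N ->
  \sum_(g < N) (eta R g)^*%R ^+ m * p.[eta R g] = N%:R * p`_m.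
Proof.
move=> mN sp.
have e0 (g : 'I_N) : eta R g != 0 := e_neq0 eta_prod g.
rewrite (eq_bigr (fun g : 'I_N => \sum_(i < size p) (eta R g)^-1 ^+ m * (p`_i * eta R g
  ^+ i))); last first.
  by move=> g _; rewrite horner_coef eta_conj mulr_sumr.
rewrite exchange_big /=.
rewrite (eq_bigr (fun i : 'I_(size p) => p`_i * ((i == m :> nat)%:R * N%:R))).
  have [ltm|lem] := ltnP m (size p).
    rewrite (bigD1 (Ordinal ltm)) //= eqxx mul1r big1 ?addr0 1?mulrC // => i.
    by rewrite -val_eqE /= => /negPf ->; rewrite mul0r mulr0.
  rewrite big1 ?nth_default ?mulr0 // => i _.
  by rewrite ltn_eqF ?mul0r ?mulr0 // (leq_trans (ltn_ord i)).
move=> i _.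
transitivity (p`_i * \sum_(g < N) (eta R g)^-1 ^+ m * eta R g ^+ i).
  by rewrite mulr_sumr; apply: eq_bigr => g _; ring.
congr (_ * _).
have iN : (i < N)%N := leq_trans (ltn_ord i) sp.
case: eqVneq => [->|im].
  transitivity (\sum_(g < N) (1 : R[i])); last by rewrite sumr_const card_ord mul1r.
  by apply: eq_bigr => g _; rewrite exprVn mulVf // expf_neq0.
rewrite mul0r; transitivity (\sum_(g < N) eta R g ^+ ((i + (N - m)) %% N)).
  apply: eq_bigr => g _.
  rewrite (expr_mod _ (eN eta_prod g)) exprD mulrC; congr (_ * _).
  rewrite exprVn -[RHS]mul1r -(mulVf (expf_neq0 m (e0 g))) -mulrA -exprD.
  by rewrite subnKC ?(eN eta_prod) ?mulr1 // ltnW.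
apply: eta_pow; rewrite ltn_mod N_gt0 andbT lt0n; apply: contra im => h.
have := divn_eq (i + (N - m)) N; rewrite (eqP h) addn0 => h2.
have q1 : ((i + (N - m)) %/ N < 2)%N by rewrite ltn_divLR //; lia.
case: ((i + (N - m)) %/ N)%N q1 h2 => [|[|]] //; rewrite ?mul0n ?mul1n; lia.
Qed.

End RootsOfUnity.

(** * Increasing listings of sets of sites *)

Section IncreasingListings.
Variables (N k : nat).
Implicit Types (z : {ffun 'I_k -> 'I_N}) (S : {set 'I_N}).

Definition increasing z : bool :=
  [forall i : 'I_k, forall j : 'I_k, (i < j)%N ==> (z i < z j)%N].

Lemma increasingE z (i j : 'I_k) : increasing z -> (z i < z j)%N = (i < j)%N.
Proof.
move=> /forallP zi; have h (i' j' : 'I_k) : (i' < j')%N -> (z i' < z j')%N.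
  by have /forallP/(_ j')/implyP := zi i'.
case: (ltngtP i j) => [/h //|/h/ltnW|/val_inj ->]; last by rewrite ltnn.
by rewrite leqNgt => /negbTE.
Qed.

Lemma increasing_inj z : increasing z -> injective z.
Proof.
move=> zi i j zij; apply: val_inj.
have := increasingE i j zi; have := increasingE j i zi; rewrite zij ltnn.
by case: ltngtP.
Qed.

(** Together with [increasing_exists], this identifies placements with pairs of disjoint sets of the
    prescribed sizes. *)
Lemma increasing_uniq z z' : increasing z -> increasing z' ->
  z @: setT = z' @: setT -> z = z'.
Proof.
move=> zi zi' im.
pose r := [rel i j : 'I_N | (i < j)%N].
have srt y : increasing y -> sorted r (map y (enum 'I_k)).
  move=> yi; rewrite sorted_map.
  have : sorted (relpre val ltn) (enum 'I_k) by rewrite -sorted_map val_enum_ord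
    iota_ltn_sorted.
  by apply: sub_sorted => i j /=; rewrite increasingE.
have E : map z (enum 'I_k) = map z' (enum 'I_k).
  apply: (@irr_sorted_eq _ r) => [x y t|x||| x] /=; [exact: ltn_trans|exact: ltnn|exact:
    srt|exact: srt|].
  have hm y : (x \in map y (enum 'I_k)) = (x \in y @: setT) :> bool.
    apply/mapP/imsetP => -[i _ ->]; exists i => //; exact: mem_enum.
  by rewrite !hm im.
apply/ffunP => i; move/eq_in_map: E; apply; exact: mem_enum.
Qed.

Lemma increasing_exists S : #|S| = k -> exists2 z, increasing z & z @: setT = S.
Proof.
move=> Sk; pose z := [ffun i : 'I_k => enum_val (cast_ord (esym Sk) i)].
exists z; last first.
  apply/setP => x; apply/imsetP/idP => [[i _ ->]|xS].
    by rewrite ffunE enum_valP.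
  exists (cast_ord Sk (enum_rank_in xS x)) => //.
  by rewrite ffunE cast_ordK enum_rankK_in.
apply/forallP => i; apply/forallP => j; apply/implyP => ij.
rewrite !ffunE; set i' := cast_ord _ i; set j' := cast_ord _ j.
pose r := [rel i j : 'I_N | (i < j)%N].
have srt : sorted r (enum S).
  rewrite /enum_mem; apply: sorted_filter; first by move=> x y t /=; exact: ltn_trans.
  have : sorted (relpre val ltn) (enum 'I_N) by rewrite -sorted_map val_enum_ord
    iota_ltn_sorted.
  by rewrite enumT.
have x0 := enum_val i'.
rewrite (enum_val_nth x0) (enum_val_nth x0 j').
apply: (@sorted_ltn_nth _ r _ x0 (enum S) srt) => //.
- by move=> x y t /=; exact: ltn_trans.
- by rewrite inE -cardE.
- by rewrite inE -cardE.
Qed.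
End IncreasingListings.

(** * States and the Hamiltonian in the basis of configurations *)

Section Coordinates.
Variables (R : realType) (N : nat).
Implicit Types (c : config N) (psi : state R N) (a b : 'I_N).

Lemma colorflipE a s t psi c :
  colorflip a s t psi c = if c a == s then psi (recolor c a t) else 0.
Proof.
rewrite /colorflip sum_ffunE.
under eq_bigr do rewrite !ffunE.
case: ifP => [/eqP cas|cas].
  rewrite (bigD1 (recolor c a t)) /=; last by rewrite ffunE eqxx.
  have -> : recolor (recolor c a t) a s = c.
    by apply/ffunP => x; rewrite !ffunE; case: eqP => // ->.
  rewrite eqxx [_%:R]/1 /= big1 ?addr0.
    exact: mulr1.
  move=> d /andP[/eqP da dne]; case: eqP => [E|_]; last exact: mulr0.
  case/eqP: dne; apply/ffunP => x; rewrite E !ffunE; case: eqP => // ->.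
  by rewrite da.
rewrite big1 // => d /eqP da; case: eqP => [E|_]; last exact: mulr0.
by rewrite E ffunE eqxx eqxx in cas.
Qed.

Definition swapc a b c : config N := [ffun x => c (tperm a b x)].

(** At the coordinate [c] only the pair of colors (c a, c b) contributes: the sum of products of
    matrix units is the transposition of two sites. *)
Lemma exchangeE a b psi c : a != b ->
  \sum_(s : color) \sum_(t : color) colorflip a s t (colorflip b t s psi) c =
  psi (swapc a b c).
Proof.
move=> ab; have ba : (b == a) = false by rewrite eq_sym (negPf ab).
transitivity (\sum_(p : color * color)
    if p == (c a, c b) then psi (swapc a b c) else 0); last first.
  by rewrite -big_mkcond (big_pred1 (c a, c b)).
rewrite pair_bigA /=; apply: eq_bigr => -[s t] _ /=; rewrite !colorflipE ffunE ba.
rewrite xpair_eqE (eq_sym (c a)) (eq_sym (c b)).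
case: eqP => // sE; case: eqP => // tE; rewrite sE tE /=.
congr (psi _); apply/ffunP => x; rewrite !ffunE.
case: tpermP => [->|->|/eqP xa /eqP xb].
- by rewrite (negPf ab) eqxx.
- by rewrite eqxx.
- by rewrite (negPf xa) (negPf xb).
Qed.

Lemma hamiltonianE psi c : hamiltonian psi c =
  (2 * pi ^+ 2 / N%:R ^+ 2 : R)%:C *
  \sum_(a < N) \sum_(b < N | (a < b)%N)
    (`|eta R a - eta R b| ^+ 2)^-1 * (psi (swapc a b c) - psi c / 3).
Proof.
rewrite /hamiltonian !ffunE sum_ffunE; congr (_ * _); apply: eq_bigr => a _.
rewrite sum_ffunE; apply: eq_bigr => b ab; rewrite !ffunE; congr (_ * _).
have ab' : a != b by rewrite -val_eqE /= neq_ltn ab.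
rewrite -(exchangeE _ _ ab') sum_ffunE.
under eq_bigr do rewrite sum_ffunE.
under eq_bigr do under eq_bigr do rewrite !ffunE.
under eq_bigr do rewrite sumrB.
rewrite sumrB; congr (_ - _).
(* Nine pairs of colors, each with the constant 1/27, give 1/3. *)
rewrite !sumr_const !card_ord -mulrnA.
rewrite -[LHS]mulr_natr; change (27%:R^-1 * psi c * (3 * 3)%:R = psi c / 3).
by field.
Qed.

Lemma colorflip_ket a s t c : c a = t ->
  colorflip a s t (ket R c) = ket R (recolor c a s).
Proof.
move=> cat; apply/ffunP => d; rewrite colorflipE !ffunE.
case: ifP => [/eqP das|das].
  congr (_%:R); congr nat_of_bool; apply/eqP/eqP => [<-|->]; apply/ffunP => x; rewrite
    !ffunE.
    by case: eqP => // ->.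
  by case: eqP => // ->.
case: eqP => // E; by rewrite E ffunE eqxx eqxx in das.
Qed.

Lemma foldr_colorflip (k : nat) (f : 'I_k -> 'I_N) s t c (l : seq 'I_k) :
  injective f -> uniq l -> (forall i, i \in l -> c (f i) = t) ->
  foldr (fun i => colorflip (f i) s t) (ket R c) l =
  ket R [ffun x => if x \in map f l then s else c x].
Proof.
move=> finj; elim: l => [|i l IH] /= => [_ _|/andP[il ul] h].
  by congr (ket R _); apply/ffunP => x; rewrite ffunE.
rewrite IH // => [|j jl]; last by apply: h; rewrite inE jl orbT.
rewrite colorflip_ket.
  congr (ket R _); apply/ffunP => x; rewrite !ffunE inE.
  by case: eqP.
by rewrite ffunE mem_map // (negPf il) h // inE eqxx.
Qed.

Definition Bset c : {set 'I_N} := [set x | c x == blue].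
Definition Rset c : {set 'I_N} := [set x | c x == red].
Definition Uset c : {set 'I_N} := [set x | c x == green].

Section Placements.
Variables (M1 M2 : nat).
Implicit Types (z : {ffun 'I_M1 -> 'I_N}) (w : {ffun 'I_M2 -> 'I_N}).

Definition conf z w : config N :=
  [ffun x => if x \in z @: setT then blue else if x \in w @: setT then red else green].

Lemma is_placementE z w : is_placement z w =
  [&& increasing z, increasing w & [forall i, forall k, z i != w k]].
Proof. by []. Qed.

Lemma mem_map_enum (k : nat) (f : {ffun 'I_k -> 'I_N}) x :
  (x \in map f (enum 'I_k)) = (x \in f @: setT).
Proof. apply/mapP/imsetP => -[i _ ->]; exists i => //; exact: mem_enum. Qed.

Lemma placedE z w : is_placement z w -> placed R z w = ket R (conf z w).
Proof.
rewrite is_placementE => /and3P[zi wi /forallP zw]; rewrite /placed /all_green.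
rewrite (foldr_colorflip _ (increasing_inj wi)) ?enum_uniq // => [|i _]; last by rewrite
  ffunE.
rewrite (foldr_colorflip _ (increasing_inj zi)) ?enum_uniq //.
  by congr (ket R _); apply/ffunP => x; rewrite !ffunE !mem_map_enum.
move=> i _; rewrite !ffunE mem_map_enum ifF //; apply/negbTE/imsetP => -[k _ E].
by have /forallP/(_ k) := zw i; rewrite E eqxx.
Qed.

Lemma Bset_conf z w : Bset (conf z w) = z @: setT.
Proof. by apply/setP => x; rewrite inE ffunE; case: ifP => //; case: ifP. Qed.

Lemma Rset_conf z w : is_placement z w -> Rset (conf z w) = w @: setT.
Proof.
rewrite is_placementE => /and3P[_ _ /forallP zw].
apply/setP => x; rewrite inE ffunE; case: ifP; last by case: ifP.
move=> /imsetP[i _ ->]; apply/esym/imsetP => -[k _ E].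
by have /forallP/(_ k) := zw i; rewrite E eqxx.
Qed.

Lemma config_eq c d : Bset c = Bset d -> Rset c = Rset d -> c = d.
Proof.
move=> hB hR; apply/ffunP => x.
have := congr1 (fun S : {set 'I_N} => x \in S) hB.
have := congr1 (fun S : {set 'I_N} => x \in S) hR; rewrite !inE.
by case: (c x) => [[|[|[|//]]] p] //; case: (d x) => [[|[|[|//]]] q] // _ _; apply:
  val_inj.
Qed.

(** A configuration comes from at most one placement, the increasing listings of its blue and red
    sites, so at most one term of the double sum is nonzero at [c]. *)
Lemma state_ofE (Psi : wavefun R M1 M2) (G : {set 'I_N} -> {set 'I_N} -> R[i]) c :
  (forall z w, is_placement z w ->
     Psi (fun i => eta R (z i)) (fun k => eta R (w k)) = G (z @: setT) (w @: setT)) ->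
  state_of N Psi c =
    if (#|Bset c| == M1) && (#|Rset c| == M2) then G (Bset c) (Rset c) else 0.
Proof.
move=> PG; rewrite /state_of sum_ffunE.
under eq_bigr do rewrite sum_ffunE.
rewrite pair_big_dep /=.
rewrite (eq_bigr (fun p => if conf p.1 p.2 == c then G (Bset c) (Rset c) else 0)); last
  first.
  move=> [z w] /= pzw; rewrite !ffunE placedE // ffunE PG // eq_sym.
  case: eqP => [<-|_]; last exact: mulr0.
  rewrite Bset_conf Rset_conf //; exact: mulr1.
rewrite -big_mkcondr; case: ifP => [/andP[/eqP cB /eqP cR]|/negbT h].
  have [z zi zB] := increasing_exists cB; have [w wi wR] := increasing_exists cR.
  have pzw : is_placement z w.
    rewrite is_placementE zi wi; apply/forallP => i; apply/forallP => k.
    apply/eqP => E.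
    have : z i \in Bset c by rewrite -zB imset_f.
    have : z i \in Rset c by rewrite E -wR imset_f.
    by rewrite !inE => /eqP ->.
  rewrite (big_pred1 (z, w)) // => -[z' w'] /=; apply/andP/eqP => [[pzw' /eqP E]|[-> ->]].
    move: (pzw'); rewrite is_placementE => /and3P[zi' wi' _].
    congr (_, _); apply: increasing_uniq => //.
      by rewrite -(Bset_conf _ w') E.
    by rewrite -(Rset_conf pzw') E.
  split=> //; apply/eqP/config_eq; first by rewrite Bset_conf.
  by rewrite Rset_conf.
apply: big1 => -[z w] /= /andP[pzw /eqP E]; exfalso; case/negP: h.
rewrite -E Bset_conf Rset_conf //.
move: pzw; rewrite is_placementE => /and3P[zi wi _].
by rewrite !card_imset ?cardsT ?card_ord ?eqxx //; exact: increasing_inj.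
Qed.

End Placements.
End Coordinates.

Section Listing.
Variables (V : comPzSemiRingType) (N k : nat) (z : {ffun 'I_k -> 'I_N}).
Hypothesis zi : increasing z.

Lemma prod_listing (f : 'I_N -> V) :
  \prod_(i < k) f (z i) = \prod_(a in z @: setT) f a.
Proof.
rewrite big_imset /=; last by move=> i j _ _; exact: increasing_inj.
by apply: eq_bigl => i; rewrite inE.
Qed.

Lemma prod_lt_listing (f : 'I_N -> 'I_N -> V) :
  \prod_(i < k) \prod_(j < k | (i < j)%N) f (z i) (z j) =
  \prod_(a in z @: setT) \prod_(b in z @: setT | (a < b)%N) f a b.
Proof.
rewrite -(prod_listing (fun a => \prod_(b in z @: setT | (a < b)%N) f a b)).
apply: eq_bigr => i _; rewrite big_mkcond [RHS]big_mkcondr /= -prod_listing.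
by apply: eq_bigr => j _; rewrite increasingE.
Qed.
End Listing.

Section PairSums.
Variables (V : nmodType) (N : nat) (f : 'I_N -> 'I_N -> V).
Hypothesis fC : forall a b, f a b = f b a.

Lemma sum_lt_twice :
  (\sum_(a < N) \sum_(b < N | (a < b)%N) f a b) *+ 2 =
  \sum_(a < N) \sum_(b < N | b != a) f a b.
Proof.
rewrite mulr2n {2}(exchange_big_dep xpredT) //= -big_split /=.
apply: eq_bigr => a _; rewrite [RHS](bigID (fun b : 'I_N => (a < b)%N)) /=.
congr (_ + _); first by apply: eq_bigl => b; rewrite -val_eqE /=; case: ltngtP.
rewrite (eq_bigr (fun b => f a b)) => [|b _]; last exact: fC.
by apply: eq_bigl => b; rewrite -val_eqE /=; case: ltngtP.
Qed.
End PairSums.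

Section Swaps.
Variables (N : nat).
Implicit Types (c : config N) (s t u : color).

Definition colset s c : {set 'I_N} := [set x | c x == s].

Variables (c : config N) (a b : 'I_N).

Lemma swapcC : swapc a b c = swapc b a c.
Proof. by apply/ffunP => x; rewrite !ffunE tpermC. Qed.

Lemma swapc_id : c a = c b -> swapc a b c = c.
Proof. by move=> cab; apply/ffunP => x; rewrite !ffunE; case: tpermP => [->|->|]. Qed.

Lemma card_colset_swapc s : #|colset s (swapc a b c)| = #|colset s c|.
Proof.
have -> : colset s (swapc a b c) = tperm a b @: colset s c.
  apply/setP => x; rewrite inE ffunE; apply/idP/imsetP => [cx|[y]].
    by exists (tperm a b x); rewrite ?inE ?tpermK.
  by rewrite inE => cy ->; rewrite tpermK.
by rewrite card_imset //; exact: perm_inj.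
Qed.

Lemma colset_swapcl s : c a = s -> c b != s -> colset s (swapc a b c) = b |: colset s c
  :\ a.
Proof.
move=> cas cbs; have ab : a != b by apply: contraNneq cbs => <-; rewrite cas.
apply/setP => x; rewrite !inE ffunE; case: tpermP => [->|->|/eqP xa /eqP xb].
- by rewrite eqxx (negPf cbs) (negPf ab).
- by rewrite cas !eqxx.
- by rewrite (negPf xa) (negPf xb).
Qed.

Lemma colset_swapc_other u : c a != u -> c b != u -> colset u (swapc a b c) = colset u c.
Proof.
move=> ca cb; apply/setP => x; rewrite !inE ffunE.
by case: tpermP => [->|->|//]; rewrite (negPf ca) (negPf cb).
Qed.
End Swaps.

(** * The Hamiltonian on the states Psi_mn *)

Section PsiStates.
Variables (R : realType) (M1 N M2 : nat).
Hypothesis NE : N = (3 * M1 + 4)%N.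
Hypothesis M2E : M2 = M1.+2.
Implicit Types (c : config N).

Local Notation e := (@eta R N).

Let N_gt0 : (0 < N)%N. Proof. by rewrite NE addn4. Qed.
Let e_inj := @eta_inj R N N_gt0.
Let e_prod := @eta_prod R N N_gt0.
Let e_pow := @eta_pow R N N_gt0.

Lemma Psi_wf_amp m n z w : (m <= M1)%N -> (n <= M1)%N -> @is_placement N M1 M2 z w ->
  Psi_wf N m n (fun i => e (z i)) (fun k => e (w k)) =
  amp e m n (z @: setT) (w @: setT).
Proof.
move=> mM nM; rewrite is_placementE => /and3P[zi wi _].
set B := z @: setT; set Rd := w @: setT.
have cB : #|B| = M1 by rewrite card_imset ?cardsT ?card_ord //; exact: increasing_inj.
have -> : amp e m n B Rd = (site_poly e B)`_m * (site_poly e B)`_n * ground e B Rd by [].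
have -> : ground e B Rd = Psi0 (fun i => e (z i)) (fun k => e (w k)).
  rewrite /Psi0 /ground /sqdiff /crossdiff (prod_lt_listing zi (fun a b => (e a - e b) ^+
    2)).
  rewrite (prod_lt_listing wi (fun a b => (e a - e b) ^+ 2)) !prod_listing //.
  congr (_ * _ * _ * _); rewrite -prod_listing //; apply: eq_bigr => i _.
  by rewrite -prod_listing.
rewrite /Psi_wf.
have N0 : N%:R != 0 :> R[i] by rewrite pnatr_eq0 -lt0n.
have szB : (size (site_poly e B) <= N)%N by rewrite size_site_poly cB NE; lia.
have coef k : (k <= M1)%N -> \sum_(g < N) (e g)^*%R ^+ k * (site_poly e B).[e g] = N%:R *
  (site_poly e B)`_k.
  by move=> kM; rewrite eta_coef // (leq_ltn_trans kM) // NE; lia.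
have -> : (site_poly e B)`_m = N%:R^-1 * \sum_(g < N) (e g)^*%R ^+ m * (site_poly e B).[e
  g].
  by rewrite coef // mulKf.
have -> : (site_poly e B)`_n = N%:R^-1 * \sum_(g < N) (e g)^*%R ^+ n * (site_poly e B).[e
  g].
  by rewrite coef // mulKf.
set P := Psi0 _ _.
transitivity ((N%:R ^+ 2)^-1 * ((\sum_(g < N) (e g)^*%R ^+ m * (site_poly e B).[e g]) *
   (\sum_(d < N) (e d)^*%R ^+ n * (site_poly e B).[e d])) * P); last by field.
rewrite -[RHS]mulrA; congr (_ * _).
rewrite mulr_suml mulr_suml; apply: eq_bigr => g _.
rewrite mulr_sumr mulr_suml; apply: eq_bigr => d _.
rewrite big_split /= !horner_site_poly -!prod_listing //.
by ring.
Qed.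

Lemma Psi_stE m n c : (m <= M1)%N -> (n <= M1)%N ->
  Psi_st R N M1 M2 m n c =
  if (#|Bset c| == M1) && (#|Rset c| == M2) then amp e m n (Bset c) (Rset c) else 0.
Proof.
move=> mM nM; rewrite /Psi_st (state_ofE _ (G := amp e m n)) // => z w pzw.
exact: Psi_wf_amp.
Qed.

Section Action.
Variable c : config N.
Local Notation B := (Bset c).
Local Notation Rd := (Rset c).
Local Notation U := (Uset c).

Lemma disjoint_colset s t : s != t -> [disjoint colset s c & colset t c].
Proof.
move=> st; rewrite disjoints_subset; apply/subsetP => x; rewrite !inE => /eqP ->.
exact: st.
Qed.

Lemma disjoint_blue_red : [disjoint B & Rd]. Proof. exact: disjoint_colset. Qed.
Lemma disjoint_blue_green : [disjoint B & U]. Proof. exact: disjoint_colset. Qed.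
Lemma disjoint_red_green : [disjoint Rd & U]. Proof. exact: disjoint_colset. Qed.

Lemma cover_colors : B :|: Rd :|: U = setT.
Proof.
by apply/setP => x; rewrite !inE; case: (c x) => [[|[|[|]]] ?].
Qed.

(** Pairs of different colors can be oriented by color and are listed once; pairs of equal color
    have no such orientation and are counted in both orders, then halved. *)
Lemma sum_pairs_by_color (f : 'I_N -> 'I_N -> R[i]) : (forall a b, f a b = f b a) ->
  \sum_(a < N) \sum_(b < N | (a < b)%N) f a b =
  \sum_(a in B) \sum_(b in U) f a b + \sum_(a in B) \sum_(b in Rd) f a b
  + \sum_(a in Rd) \sum_(b in U) f a b
  + (\sum_(a in B) \sum_(b in B | b != a) f a b
     + \sum_(a in Rd) \sum_(b in Rd | b != a) f a b
     + \sum_(a in U) \sum_(b in U | b != a) f a b) / 2.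
Proof.
move=> fC; have := sum_lt_twice fC; set W := \sum_(a < N) _ => h.
have -> : W = (W *+ 2) / 2 by rewrite mulr2n; field.
rewrite h -(partition_sum disjoint_blue_red disjoint_blue_green disjoint_red_green
  cover_colors xpredT).
rewrite ![\sum_(b in _ | true) _](eq_bigl _ _ (fun i => andbT _)).
have spl (S : {set 'I_N}) : \sum_(a in S) \sum_(b < N | b != a) f a b =
   \sum_(a in S) \sum_(b in B | b != a) f a b + \sum_(a in S) \sum_(b in Rd | b != a) f a
     b
   + \sum_(a in S) \sum_(b in U | b != a) f a b.
  rewrite -!big_split; apply: eq_bigr => a _.
  by rewrite -(partition_sum disjoint_blue_red disjoint_blue_green disjoint_red_green
    cover_colors).
have cross (S T : {set 'I_N}) : [disjoint S & T] -> \sum_(a in S) \sum_(b in T | b != a)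
  f a b
    = \sum_(a in S) \sum_(b in T) f a b.
  by move=> dST; apply: eq_bigr => a aS; rewrite (sum_disjoint _ dST aS).
have cross' (S T : {set 'I_N}) : [disjoint T & S] -> \sum_(a in S) \sum_(b in T | b != a)
  f a b
    = \sum_(a in T) \sum_(b in S) f a b.
  rewrite disjoint_sym => dST; rewrite cross // exchange_big.
  by do 2![apply: eq_bigr => ? _].
rewrite !spl (cross _ _ disjoint_blue_red) (cross _ _ disjoint_blue_green) (cross _ _
  disjoint_red_green).
rewrite (cross' _ _ disjoint_blue_red) (cross' _ _ disjoint_blue_green) (cross' _ _
  disjoint_red_green).
by field.
Qed.

Lemma hamiltonian_Psi m n : (m <= M1)%N -> (n <= M1)%N ->
  hamiltonian (Psi_st R N M1 M2 m n) c =
  (2 * pi ^+ 2 / N%:R ^+ 2 : R)%:C *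
  ((- (N%:R ^+ 2 / 36 * (N%:R - 17 / N%:R + 52 / N%:R ^+ 2))
   + 3 / 2 * ((M1%:R - m%:R) * m%:R + (M1%:R - n%:R) * n%:R - 2 / 3 * (m%:R - n%:R)))
     * Psi_st R N M1 M2 m n c
  - 2 * \sum_(1 <= l < (ell_max M1 m n).+1) (m%:R - n%:R + 2 * l%:R)
         * Psi_st R N M1 M2 (m + l) (n - l) c).
Proof.
move=> mM nM; rewrite hamiltonianE; congr (_ * _).
set psi := Psi_st R N M1 M2 m n.
have lE l : (1 <= l < (ell_max M1 m n).+1)%N -> (m + l <= M1)%N && (n - l <= M1)%N.
  by rewrite /ell_max; lia.
(* Exchanges preserve the number of sites of each color, so both sides vanish on configurations with
   the wrong numbers. *)
case szE: ((#|B| == M1) && (#|Rd| == M2)); last first.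
  have psi0 k l : (k <= M1)%N -> (l <= M1)%N -> Psi_st R N M1 M2 k l c = 0.
    by move=> kM lM; rewrite Psi_stE // szE.
  have psiS a b : psi (swapc a b c) = 0.
    rewrite /psi Psi_stE // -[Bset _]/(colset blue _) -[Rset _]/(colset red _).
    by rewrite !card_colset_swapc szE.
  rewrite /psi psi0 // big1 => [|a _]; last first.
    by rewrite big1 // => b _; rewrite -/psi psiS mul0r subrr mulr0.
  rewrite mulr0 big_nat_cond big1 ?mulr0 ?subrr // => l /andP[/lE /andP[h1 h2] _].
  by rewrite psi0 // mulr0.
have [/eqP cB /eqP cR] := andP szE.
have ampE k l : (k <= M1)%N -> (l <= M1)%N ->
   Psi_st R N M1 M2 k l c = amp e k l B Rd.
  by move=> kM lM; rewrite Psi_stE // szE.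
have swE a b : psi (swapc a b c) = amp e m n (colset blue (swapc a b c)) (colset red
  (swapc a b c)).
  rewrite /psi Psi_stE // -[Bset _]/(colset blue _) -[Rset _]/(colset red _).
  by rewrite !card_colset_swapc szE.
have dE (a b : 'I_N) : (a < b)%N -> (`|e a - e b| ^+ 2)^-1 = dinv e a b.
  by move=> ab; rewrite eta_dist // -val_eqE /= neq_ltn ab.
rewrite (eq_bigr (fun a : 'I_N => \sum_(b < N | (a < b)%N) (dinv e a b * psi (swapc a b c)
    - dinv e a b * (psi c / 3)))); last first.
  by move=> a _; apply: eq_bigr => b ab; rewrite dE // mulrBr.
under eq_bigr do rewrite sumrB -mulr_suml.
rewrite sumrB -mulr_suml.
have dsum : \sum_(a < N) \sum_(b < N | (a < b)%N) dinv e a b = N%:R * lattice_dinv R[i] N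
  / 2.
  have h : \sum_(a < N) \sum_(b < N | b != a) dinv e a b = N%:R * lattice_dinv R[i] N.
    rewrite (eq_bigr (fun=> lattice_dinv R[i] N)) => [|a _]; last exact: (dinv_sum e_inj
      e_prod).
    by rewrite sumr_const card_ord mulr_natl.
  by rewrite -h -(sum_lt_twice (dinvC e)) mulr2n; field.
rewrite dsum sum_pairs_by_color => [|a b]; last by rewrite dinvC swapcC.
have ne (s t : color) x : s != t -> c x == s -> c x != t by move=> st /eqP ->.
rewrite (eq_bigr (fun a : 'I_N => \sum_(b in U) dinv e a b * amp e m n (b |: B :\ a)
  Rd)); last first.
  move=> a; rewrite inE => ca; apply: eq_bigr => b; rewrite inE => cb; rewrite swE.
  by rewrite colset_swapcl ?(ne _ _ _ _ cb) ?(eqP ca) // colset_swapc_other ?(ne _ _ _ _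
    cb) ?(ne _ _ _ _ ca).
rewrite [X in _ + X + _ + _](eq_bigr (fun a : 'I_N => \sum_(b in Rd) dinv e a b * amp e m
  n (b |: B :\ a) (a |: Rd :\ b))); last first.
  move=> a; rewrite inE => ca; apply: eq_bigr => b; rewrite inE => cb; rewrite swE.
  rewrite colset_swapcl ?(ne _ _ _ _ cb) ?(eqP ca) //.
  by rewrite swapcC colset_swapcl ?(ne _ _ _ _ ca) ?(eqP cb).
rewrite [X in _ + X + _](eq_bigr (fun a : 'I_N => \sum_(b in U) dinv e a b * amp e m n B
  (b |: Rd :\ a))); last first.
  move=> a; rewrite inE => ca; apply: eq_bigr => b; rewrite inE => cb; rewrite swE.
  by rewrite [colset red _]colset_swapcl ?(ne _ _ _ _ cb) ?(eqP ca) // colset_swapc_other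
    ?(ne _ _ _ _ cb) ?(ne _ _ _ _ ca).
have same s : \sum_(a in colset s c) \sum_(b in colset s c | b != a) dinv e a b * psi
  (swapc a b c)
    = (\sum_(a in colset s c) DS e (colset s c) a) * psi c.
  rewrite mulr_suml; apply: eq_bigr => a; rewrite inE => ca; rewrite mulr_suml.
  apply: eq_bigr => b; rewrite inE => /andP[cb _]; rewrite swapc_id //.
  by rewrite (eqP ca) (eqP cb).
rewrite (same blue) (same red) (same green).
have psiE : psi c = amp e m n B Rd by exact: ampE.
have cR' : #|Rd| = M1.+2 by rewrite cR.
have key := amp_action e_inj e_prod e_pow disjoint_blue_red disjoint_blue_green
  disjoint_red_green cover_colors cB cR' NE m n.
rewrite psiE; transitivity ((- (N%:R ^+ 2 / 36 * (N%:R - 17 / N%:R + 52 / N%:R ^+ 2))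
   + 3 / 2 * ((M1%:R - m%:R) * m%:R + (M1%:R - n%:R) * n%:R - 2 / 3 * (m%:R - n%:R)))
     * amp e m n B Rd
  - 2 * \sum_(1 <= l < n.+1) (m%:R - n%:R + 2 * l%:R) * amp e (m + l) (n - l) B Rd).
  by rewrite -key; field.
congr (_ - 2 * _).
(* For l between [ell_max M1 m n] + 1 and n the index m + l exceeds M1, the degree of
   [site_poly e B], so these terms vanish. *)
have nl : ((ell_max M1 m n).+1 <= n.+1)%N by rewrite ltnS geq_minr.
rewrite (big_cat_nat (n := (ell_max M1 m n).+1)) //= [X in _ + X]big_nat_cond [X in _ +
  X]big1 ?addr0.
  by apply: eq_big_nat => l /lE /andP[h1 h2]; rewrite ampE.
move=> l /andP[/andP[h1 h2] _].
have : (M1 < m + l)%N by move: h1 h2; rewrite /ell_max; lia.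
move=> h; rewrite /amp [(site_poly _ _)`_(m + l)]nth_default ?mul0r ?mulr0 //.
by rewrite size_site_poly cB.
Qed.

End Action.
End PsiStates.

(** * The eigenvector *)

Section CoefSums.
Variables (R : realType) (m n : nat).
Hypothesis nm : (n <= m)%N.
Local Notation d := (m%:R - n%:R : R).

(* The recursion for the coefficients is the quotient of two successive
   instances of this triangular system for the eigenvector. *)
Lemma coef_a_sum j :
  coef_a R m n j.+1 * (3 * j.+1%:R * (d + j.+1%:R + 2 / 3)) =
  - 2 * (d + 2 * j.+1%:R) * \sum_(0 <= l < j.+1) coef_a R m n l.
Proof.
have d0 : 0 <= d by rewrite subr_ge0 ler_nat.
elim: j => [|j IH].
  rewrite big_nat1 /= eqxx andbT.
  (* For m = n the prescribed value -4/5 is the solution of 5 a_1 = -4, the equation to be proved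
     with d = 0. *)
  case: eqVneq => [mn|mn]; first by rewrite mn; field.
  have d1 : 0 < d by rewrite subr_gt0 ltr_nat ltn_neqAle eq_sym mn nm.
  by move: d1; set d' := d => d1; field; rewrite !gt_eqF //; lra.
rewrite big_nat_recr //=.
have j0 : 0 <= j%:R :> R by rewrite ler0n.
have S : \sum_(0 <= l < j.+1) coef_a R m n l =
   - (coef_a R m n j.+1 * (3 * j.+1%:R * (d + j.+1%:R + 2 / 3))) / (2 * (d + 2 *
     j.+1%:R)).
  rewrite IH -[j.+1]addn1 natrD; move: d0; set d' := d => d0; field.
  by rewrite gt_eqF //; lra.
rewrite S [in LHS]/coef_a -/(coef_a R m n j.+1) andbF.
move: (coef_a R m n j.+1) => x.
rewrite -[j.+2]addn2 -[j.+1]addn1 !natrD; move: d0; set d' := d => d0.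
by field; rewrite !gt_eqF //; lra.
Qed.
End CoefSums.

(** * Forms on lattice points that do not vanish identically *)

Section Grid.
Variables (C : fieldType) (N : nat) (e : 'I_N -> C).
Hypothesis e_inj : injective e.
Variables (M1 m n L : nat) (a : nat -> C).
Hypothesis MN : (M1.+2 <= N)%N.

Definition roots_poly (s : seq C) : {poly C} := \prod_(x <- s) ('X - x%:P).

(** For [a] the eigenvector coefficients and [L] one more than [ell_max], this is the amplitude of
    Phi_mn divided by the ground factor, with the roots of [p] as blue coordinates. *)
Definition qform (p : {poly C}) : C := \sum_(0 <= l < L) a l * (p`_(m + l) * p`_(n - l)).

(* The roots are freed from the grid one at a time: in each of them the form has
   degree at most 2, and it vanishes at all the sites left unoccupied. *)
Lemma qform_vanish :
  (forall l : seq 'I_N, uniq l -> size l = M1 -> qform (roots_poly (map e l)) = 0) ->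
  forall s : seq C, size s = M1 -> qform (roots_poly s) = 0.
Proof.
move=> H0.
suff H s1 l : uniq l -> (size s1 + size l = M1)%N -> qform (roots_poly (s1 ++ map e l)) =
  0.
  by move=> s ss; rewrite -[s]cats0; apply: (H s [::]); rewrite ?addn0.
elim: s1 l => [|x s1 IH] l ul sz; first exact: H0.
pose W := roots_poly (s1 ++ map e l).
pose lin k : {poly C} := (('X * W)`_k)%:P - W`_k *: 'X.
pose q := \sum_(0 <= i < L) a i *: (lin (m + i)%N * lin (n - i)%N).
have linE k t : (lin k).[t] = (('X - t%:P) * W)`_k.
  by rewrite mulrBl coefB coefCM /lin hornerD hornerN hornerC hornerZ hornerX; ring.
have qE t : q.[t] = qform (('X - t%:P) * W).
  rewrite /q horner_sum; apply: eq_bigr => i _.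
  by rewrite hornerZ hornerM !linE.
have qx : qform (roots_poly ((x :: s1) ++ map e l)) = q.[x].
  by rewrite qE /roots_poly /= big_cons.
have slin k : (size (lin k) <= 2)%N.
  rewrite (leq_trans (size_polyD _ _)) // geq_max.
  rewrite (leq_trans (size_polyC_leq1 _)) // size_polyN.
  by rewrite (leq_trans (size_scale_leq _ _)) // size_polyX.
have sq : (size q <= 3)%N.
  rewrite (leq_trans (size_sum _ _ _)) //; apply/bigmax_leqP_seq => i _ _.
  rewrite (leq_trans (size_scale_leq _ _)) // (leq_trans (size_polyMleq _ _)) //.
  have := slin (m + i)%N; have := slin (n - i)%N.
  by case: (size _) => [|[|[|]]] //; case: (size _) => [|[|[|]]].
rewrite qx (_ : q = 0) ?horner0 //.
(* At most M1 - 1 sites are occupied by [l], so [MN] leaves at least three free sites, more than the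
   degree of [q]. *)
pose r := [seq b <- enum 'I_N | b \notin l].
apply: (@roots_geq_poly_eq0 _ _ (map e r)).
- apply/allP => y /mapP[b]; rewrite mem_filter => /andP[bl _] ->.
  rewrite /root qE; have := IH (b :: l).
  rewrite /= bl => /(_ ul); rewrite -addSnnS => /(_ sz).
  rewrite /roots_poly big_cat big_cons /= mulrCA -big_cat => <-.
  by rewrite /W /roots_poly.
- by rewrite map_inj_uniq // filter_uniq // enum_uniq.
- rewrite size_map (leq_trans sq) // size_filter.
  have := count_predC (mem l) (enum 'I_N); rewrite -cardE card_ord.
  have -> : count (mem l) (enum 'I_N) = size l.
    rewrite -size_filter; apply/perm_size/uniq_perm => //.
      by rewrite filter_uniq // enum_uniq.
    by move=> b; rewrite mem_filter mem_enum andbT.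
  rewrite -[X in (_ <= X)%N]/(count (predC (mem l)) (enum 'I_N)).
  move: (count _ _) sz => k /=; lia.
Qed.

(* A polynomial whose only nonzero coefficients sit at m, n and M1 isolates the
   term l = 0 of the form. *)
Lemma qform_neq0 (decC : forall p : {poly C}, p \is monic -> {s | p = roots_poly s}) :
  (n <= m)%N -> (m <= M1)%N -> (0 < L)%N -> (L <= n.+1)%N -> a 0%N = 1 ->
  exists2 l : seq 'I_N, uniq l /\ size l = M1 & qform (roots_poly (map e l)) != 0.
Proof.
move=> nm mM L0 Ln a0.
have [/existsP[t /andP[ul h]]|H] := boolP [exists t : M1.-tuple 'I_N,
    uniq t && (qform (roots_poly (map e t)) != 0)].
  by exists t => //; rewrite size_tuple.
exfalso.
pose p : {poly C} := \poly_(i < M1.+1) ((i == m) || (i == n) || (i == M1))%:R.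
have lc : p`_M1 = 1 by rewrite coef_poly ltnSn eqxx orbT.
have sp : size p = M1.+1.
  by apply: size_poly_eq; rewrite eqxx orbT oner_eq0.
have mp : p \is monic by rewrite monicE lead_coefE sp lc.
have [s ps] := decC p mp.
have ss : size s = M1.
  by move: sp; rewrite ps /roots_poly size_prod_XsubC => -[].
have : qform (roots_poly s) = 0.
  apply: qform_vanish ss => l ul sl; apply/eqP; apply: contraNT H => h.
  by apply/existsP; exists (tcast sl (in_tuple l)); rewrite val_tcast /= ul.
rewrite -ps /qform big_ltn // addn0 subn0 a0 mul1r !coef_poly !ltnS mM (leq_trans nm mM)
  !eqxx orbT.
rewrite mul1r big_nat_cond big1 ?addr0; first by move/eqP; rewrite oner_eq0.
move=> l /andP[/andP[l1 l2] _]; rewrite [X in _ * (_ * X)]coef_poly.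
have -> : (n - l == m)%N || (n - l == n)%N || (n - l == M1)%N = false by lia.
by rewrite if_same !mulr0.
Qed.
End Grid.

(** * The eigenvalue equation and the nonvanishing of Phi_mn *)

Section Eigenstates.
Variables (R : realType) (M1 N M2 m n : nat).
Hypothesis NE : N = (3 * M1 + 4)%N.
Hypothesis M2E : M2 = M1.+2.
Hypothesis nm : (n <= m)%N.
Hypothesis mM : (m <= M1)%N.

Local Notation L := (ell_max M1 m n).
Local Notation a := (coef_a R m n).
Local Notation Psi := (Psi_st R N M1 M2).
Local Notation K := (2 * pi ^+ 2 / N%:R ^+ 2 : R).

Lemma hamiltonian_sum (I : Type) (r : seq I) (f : I -> R[i]) (psi : I -> state R N) (c :
  config N) :
  hamiltonian (\sum_(l <- r) f l *: psi l) c = \sum_(l <- r) f l * hamiltonian (psi l) c.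
Proof.
have SE d : (\sum_(l <- r) f l *: psi l) d = \sum_(l <- r) f l * psi l d.
  by rewrite sum_ffunE; apply: eq_bigr => l _; rewrite ffunE.
move: (\sum_(l <- r) f l *: psi l) SE => S SE.
rewrite [LHS]hamiltonianE.
under [RHS]eq_bigr do rewrite [X in _ * X]hamiltonianE mulrCA.
rewrite -[RHS]mulr_sumr; congr (_ * _).
under [RHS]eq_bigr do rewrite mulr_sumr.
rewrite [RHS]exchange_big; apply: eq_bigr => x _ /=.
under [RHS]eq_bigr do rewrite mulr_sumr.
rewrite [RHS]exchange_big; apply: eq_bigr => y _ /=.
rewrite !SE mulr_suml -sumrB mulr_sumr; apply: eq_bigr => l _.
by move: (psi l _) (psi l _) => u v; ring.
Qed.

(* The diagonal entry of N ^+ 2 / (2 pi ^+ 2) * H at Psi_(p, q). *)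
Definition eps (p q : nat) : R :=
  - (N%:R ^+ 2 / 36 * (N%:R - 17 / N%:R + 52 / N%:R ^+ 2))
  + 3 / 2 * ((M1%:R - p%:R) * p%:R + (M1%:R - q%:R) * q%:R - 2 / 3 * (p%:R - q%:R)).

Lemma N_neq0 : N%:R != 0 :> R.
Proof. by rewrite pnatr_eq0 NE addn4. Qed.

Lemma eps_energy : K * eps m n = energy R N M1 m n.
Proof. by rewrite /eps /energy; field; exact: N_neq0. Qed.

Lemma hamiltonian_PsiR p q (c : config N) : (p <= M1)%N -> (q <= M1)%N ->
  hamiltonian (Psi p q) c = K%:C * ((eps p q)%:C * Psi p q c
    - 2 * \sum_(1 <= l < (ell_max M1 p q).+1) (p%:R - q%:R + 2 * l%:R) * Psi (p + l)%N (q
      - l)%N c).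
Proof.
move=> pM qM; rewrite (hamiltonian_Psi _ NE M2E) //; congr (_ * (_ * _ - _)).
have N0 : N%:R != 0 :> R[i] by rewrite pnatr_eq0 NE addn4.
by rewrite /eps; field; rewrite ?N0 ?N_neq0.
Qed.

(** The eigenvalue equation at the component Psi_(m+j,n-j). It reduces to [coef_a_sum] because
    [eps m n] - [eps (m + j) (n - j)] = 3 j (m - n + j + 2/3). *)
Lemma coef_balance j : (j <= n)%N ->
  a j * eps (m + j) (n - j) - 2 * (m%:R - n%:R + 2 * j%:R) * \sum_(0 <= l < j) a l
  = eps m n * a j.
Proof.
move=> jn; case: j jn => [|j] jn; first by rewrite big_geq // addn0 subn0; ring.
transitivity (a j.+1 * eps (m + j.+1) (n - j.+1)
    + a j.+1 * (3 * j.+1%:R * (m%:R - n%:R + j.+1%:R + 2 / 3))).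
  by rewrite coef_a_sum //; ring.
rewrite /eps natrB // natrD; move: (a _) (j.+1%:R : R) N_neq0 => x y N0.
by field.
Qed.

Lemma triangle_sum (V : nmodType) k (F : nat -> nat -> V) :
  \sum_(0 <= l < k.+1) \sum_(1 <= i < (k - l).+1) F l (l + i)%N =
  \sum_(0 <= j < k.+1) \sum_(0 <= l < j) F l j.
Proof.
transitivity (\sum_(0 <= l < k.+1) \sum_(0 <= j < k.+1 | (l < j)%N) F l j).
  apply: eq_big_nat => l /andP[_ lk].
  transitivity (\sum_(1 + l <= j < k.+1) F l j).
    by rewrite big_addn subSn //; apply: eq_bigr => i _; rewrite addnC.
  by rewrite (big_nat_widenl _ 0%N).
rewrite (exchange_big_dep_nat xpredT) //=; apply: eq_big_nat => j /andP[_ jk].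
by rewrite [RHS](big_nat_widen _ _ k.+1) 1?ltnW.
Qed.

Lemma hamiltonian_Phi :
  hamiltonian (Phi_st R N M1 M2 m n) = (energy R N M1 m n)%:C *: Phi_st R N M1 M2 m n.
Proof.
apply/ffunP => c; rewrite {1}/Phi_st hamiltonian_sum ffunE /Phi_st sum_ffunE.
rewrite -eps_energy.
have lE l : (0 <= l < L.+1)%N -> [/\ (l <= n)%N, (m + l <= M1)%N, (n - l <= M1)%N
    & ell_max M1 (m + l) (n - l) = (L - l)%N].
  by rewrite /ell_max => h; split; lia.
(* Shifting the indices by l shortens the range of i to L - l, and the weight (m + l) - (n - l) + 2
   i equals m - n + 2 (l + i). Summation over j = l + i then isolates each component. *)
transitivity (K%:C * (\sum_(0 <= l < L.+1) (a l)%:C * (eps (m + l) (n - l))%:C * Psi (m +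
  l)%N (n - l)%N c
   - 2 * \sum_(0 <= l < L.+1) \sum_(1 <= i < (L - l).+1) (a l)%:C *
       (m%:R - n%:R + 2 * (l + i)%:R) * Psi (m + (l + i))%N (n - (l + i))%N c)).
  rewrite [X in _ = _ * (_ - X)]mulr_sumr -sumrB mulr_sumr; apply: eq_big_nat => l /lE
    [ln h1 h2 h3].
  rewrite hamiltonian_PsiR // h3 mulrCA; congr (_ * _); rewrite mulrBr mulrA; congr (_ -
    _).
  rewrite mulrCA; congr (_ * _); rewrite mulr_sumr; apply: eq_bigr => i _.
  rewrite addnA subnDA mulrA; congr (_ * _ * _).
  by rewrite natrB // !natrD; ring.
rewrite (triangle_sum L (fun l j => (a l)%:C * (m%:R - n%:R + 2 * j%:R)
  * Psi (m + j)%N (n - j)%N c)).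
rewrite [X in X *: _]rmorphM -scalerA; congr (_ * _).
rewrite [X in _ - X = _]mulr_sumr -sumrB [RHS]mulr_sumr; apply: eq_big_nat => j /lE [jn _
  _ _].
rewrite ffunE; set p := Psi _ _ c.
have dC : (m%:R - n%:R + 2 * j%:R : R)%:C = m%:R - n%:R + 2 * j%:R.
  by rewrite rmorphD rmorphB rmorphM !rmorph_nat.
have h : (a j)%:C * (eps (m + j) (n - j))%:C
    - 2 * (m%:R - n%:R + 2 * j%:R) * \sum_(0 <= l < j) (a l)%:C
    = (eps m n)%:C * (a j)%:C.
  have := congr1 (real_complex R) (coef_balance jn).
  rewrite rmorphB !rmorphM rmorph_sum [X in X * \sum_(0 <= l < _) _](_ : _ = 2 * (m%:R -
    n%:R + 2 * j%:R)) //.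
  by rewrite -dC rmorph_nat.
rewrite -!mulr_suml.
transitivity (((eps m n)%:C * (a j)%:C) * p); last by rewrite /GRing.scale /= mulrA.
by rewrite -h; ring.
Qed.

Lemma Phi_neq0 : Phi_st R N M1 M2 m n != 0.
Proof.
have N0 : (0 < N)%N by rewrite NE addn4.
pose e := @eta R N.
pose aC l : R[i] := (a l)%:C.
have decC (p : {poly R[i]}) : p \is monic -> {s | p = roots_poly s}.
  move=> mp; have [s] := closed_field_poly_normal p.
  by rewrite (monicP mp) scale1r => ->; exists s.
have MN : (M1.+2 <= N)%N by rewrite NE; lia.
have LnS : (L.+1 <= n.+1)%N by rewrite ltnS geq_minr.
have [s [us ss] qs] := @qform_neq0 _ _ e (eta_inj N0) M1 m n L.+1 aC MN decC nm mM isT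
  LnS erefl.
pose B := [set x in s].
have cB : #|B| = M1 by rewrite cardsE (card_uniqP us).
have ZB : roots_poly (map e s) = site_poly e B.
  rewrite /roots_poly big_map /site_poly big_uniq //=.
  by apply: eq_bigl => x; rewrite inE.
(* Any M2 sites outside [B] serve as red sites: the ground factor is nonzero on disjoint sets, so
   the amplitude vanishes only if the form does. *)
pose Rd := [set x in take M2 (enum (~: B))].
have cR : #|Rd| = M2.
  have ut : uniq (take M2 (enum (~: B))) by rewrite take_uniq ?enum_uniq.
  rewrite cardsE (card_uniqP ut) size_takel // -cardE.
  have := cardsC B; rewrite card_ord cB; have := NE; have := M2E.
  move: #|_| => k; lia.
have BR x : x \in Rd -> x \in B = false.
  by rewrite inE => /mem_take; rewrite mem_enum inE => /negbTE.
pose c : config N := [ffun x => if x \in B then blue else if x \in Rd then red else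
  green].
have Bc : Bset c = B.
  by apply/setP => x; rewrite inE ffunE; case: ifP => // _; case: ifP.
have Rc : Rset c = Rd.
  apply/setP => x; rewrite inE ffunE.
  by case xR: (x \in Rd); [rewrite BR|case: ifP].
apply/eqP => /(congr1 (fun psi : state R N => psi c)).
rewrite /Phi_st sum_ffunE ffunE.
rewrite (eq_big_nat _ _ (F2 := fun l => aC l * ((site_poly e B)`_(m + l) * (site_poly e
  B)`_(n - l)) * ground e B Rd)).
  rewrite -mulr_suml => /eqP; rewrite mulf_eq0 -ZB (negPf qs) /=.
  apply/negP; apply: (ground_neq0 (eta_inj N0) (eta_prod R N0)).
  by rewrite -Bc -Rc; exact: disjoint_blue_red.
move=> l lL; have [h1 h2] : (m + l <= M1)%N /\ (n - l <= M1)%N.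
  by move: lL; rewrite /ell_max; split; lia.
by rewrite ffunE (Psi_stE _ NE M2E) // Bc Rc cB cR !eqxx /= -mulrA.
Qed.

End Eigenstates.

Theorem mainTheorem2 (R : realType) (M N M1 M2 m n : nat)
    (hM : (2 <= M)%N) (hN : N = (3 * M - 2)%N)
    (hM1 : M1 = ((N - 4) %/ 3)%N) (hM2 : M2 = ((N + 2) %/ 3)%N)
    (hnm : (n <= m)%N) (hm : (m <= M1)%N) :
  [/\ hamiltonian (Psi_st R N M1 M2 m n) =
        (- (pi ^+ 2 / 18%:R) * (N%:R - 17%:R / N%:R + 52%:R / N%:R ^+ 2) : R)%:C
          *: Psi_st R N M1 M2 m n
        + (3%:R * pi ^+ 2 / N%:R ^+ 2 *
            ((M1%:R - m%:R) * m%:R + (M1%:R - n%:R) * n%:R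
             - 2 / 3%:R * (m%:R - n%:R)) : R)%:C
          *: Psi_st R N M1 M2 m n
        - (4%:R * pi ^+ 2 / N%:R ^+ 2 : R)%:C
          *: (\sum_(1 <= l < (ell_max M1 m n).+1)
                (m%:R - n%:R + 2 * l%:R : R)%:C
                  *: Psi_st R N M1 M2 (m + l) (n - l)),
      is_eigenstate (energy R N M1 m n) (Phi_st R N M1 M2 m n),
      energy R N M1 m n =
        E0 R N + 4%:R / 9%:R * (pi ^+ 2 / N%:R ^+ 2)
        + dispersion (momentum_m R N m) + dispersion (momentum_n R N n)
    & exists k : int,
        momentum_n R N n - momentum_m R N m =
        2 * pi / N%:R * (2 / 3%:R + k%:~R)].
Proof.
(* Both divisions are exact: M1 = M - 2 and M2 = M. *)
have NE : N = (3 * M1 + 4)%N by lia.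
have M2E : M2 = M1.+2 by lia.
have N0 := @N_neq0 R M1 N NE.
split.
- apply/ffunP => c; rewrite (hamiltonian_PsiR R NE M2E) ?(leq_trans hnm) //.
  rewrite !ffunE [X in _ = _ - _ *: X]sum_ffunE.
  set p := Psi_st R N M1 M2 m n c; set K := (2 * pi ^+ 2 / N%:R ^+ 2 : R).
  rewrite mulrBr; congr (_ - _).
    rewrite mulrA -[_%:C * _%:C]rmorphM -[LHS]/((_ : R[i]) * p).
    transitivity ((energy R N M1 m n)%:C * p); first by rewrite -(eps_energy R m n NE).
    by rewrite /energy rmorphD mulrDl.
  rewrite mulrA mulr_sumr [RHS]mulr_sumr; apply: eq_bigr => l _.
  rewrite !ffunE; move: (Psi_st _ _ _ _ _ _ c) => u.
  rewrite /K [RHS]mulrA [LHS]mulrA; congr (_ * u).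
  by field; rewrite pnatr_eq0 NE addn4.
- by split; [exact: Phi_neq0|exact: hamiltonian_Phi].
- rewrite /energy /E0 /dispersion /momentum_m /momentum_n.
  have M1r : M1%:R = (N%:R - 4) / 3 :> R by rewrite NE natrD natrM; field.
  by rewrite M1r; field.
(* The fraction 2/3 is the difference of the offsets 1 and 1/3 in the two momenta. *)
- exists (m%:Z - n%:Z); rewrite /momentum_m /momentum_n rmorphB /= -!pmulrn.
  by field.
Qed.
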